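(* Let $T$ be a set with a distinguished element $\bot\in T$, and let a class of total maps $\mathbb{N}\to T$, called enumerations, be given satisfying: (1) if $\nu$ is an enumeration and $f:\mathbb{N}\to\mathbb{N}$ is partial computable, then $\mu(n)=\nu(f(n))$ if $f(n)$ is defined and $\mu(n)=\bot$ otherwise defines an enumeration $\mu$; (2) there is an enumeration $\nu$ such that for every enumeration $\mu$ there is a total computable $h$ with $\mu(n)=\nu(h(n))$ for all $n$; (3) for every enumeration $\tau$ and every enumerable set $G\subseteq\mathbb{N}$ there is an enumeration $\rho$ with $\rho(x)=\tau(x)$ for $x\notin G$ and $\rho(x)\ne\bot$ for $x\in G$. Let $\nu$ and $\nu'$ be two effectively optimal enumerations. Then there exists a computable bijection $h:\mathbb{N}\to\mathbb{N}$ such that both $h$ and $h^{-1}$ are length-bounded and $\nu'(x)=\nu(h(x))$ for all $x\in\mathbb{N}$.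
   Context: Natural numbers are identified with binary strings in the standard (length-lexicographic) way. A total function $h$ is length-bounded if $|h(x)|\le|x|+c$ for some $c$ and all $x$ (equivalently, $h(n)=O(n)$ for natural numbers). An enumeration $\omega$ is effectively optimal if for every enumeration $\mu$ there exists a total computable length-bounded $h$ with $\mu(x)=\omega(h(x))$ for all $x$. *)

(* Defs.v *)
From Stdlib Require Import List Arith PeanoNat.
Import ListNotations.

Inductive prf : Type :=
| PZero : prf
| PSucc : prf
| PProj : nat -> prf
| PComp : prf -> list prf -> prf
| PPrim : prf -> prf -> prf
| PMu   : prf -> prf.

Inductive evalp : prf -> list nat -> nat -> Prop :=
| eZero xs : evalp PZero xs 0
| eSucc x xs : evalp PSucc (x :: xs) (S x)
| eProj i xs : i < length xs -> evalp (PProj i) xs (nth i xs 0)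
| eComp f gs xs ys y : evals gs xs ys -> evalp f ys y -> evalp (PComp f gs) xs y
| ePrim0 f g xs y : evalp f xs y -> evalp (PPrim f g) (0 :: xs) y
| ePrimS f g n xs r y :
    evalp (PPrim f g) (n :: xs) r -> evalp g (n :: r :: xs) y ->
    evalp (PPrim f g) (S n :: xs) y
| eMu f xs n :
    evalp f (n :: xs) 0 ->
    (forall m, m < n -> exists z, z <> 0 /\ evalp f (m :: xs) z) ->
    evalp (PMu f) xs n
with evals : list prf -> list nat -> list nat -> Prop :=
| esNil xs : evals [] xs []
| esCons g gs xs y ys : evalp g xs y -> evals gs xs ys -> evals (g :: gs) xs (y :: ys).

Definition partial_computable (f : nat -> option nat) : Prop :=
  exists p : prf, forall n y, evalp p [n] y <-> f n = Some y.

Definition total_computable (h : nat -> nat) : Prop :=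
  exists p : prf, forall n, evalp p [n] (h n).

Definition enumerable (G : nat -> Prop) : Prop :=
  exists p : prf, forall x, G x <-> exists y, evalp p [x] y.

(* Length of the binary string identified with n in the length-lexicographic
   order (0 = empty string, 1 = "0", 2 = "1", 3 = "00", ...). *)
Definition blen (n : nat) : nat := Nat.log2 (S n).

Definition length_bounded (h : nat -> nat) : Prop :=
  exists c, forall x, blen (h x) <= blen x + c.

Definition enum_axiom1 {T : Type} (bot : T) (E : (nat -> T) -> Prop) : Prop :=
  forall nu, E nu -> forall f : nat -> option nat, partial_computable f ->
    E (fun n => match f n with Some m => nu m | None => bot end).

Definition enum_axiom2 {T : Type} (E : (nat -> T) -> Prop) : Prop :=
  exists nu, E nu /\ forall mu, E mu ->
    exists h, total_computable h /\ forall n, mu n = nu (h n).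

Definition enum_axiom3 {T : Type} (bot : T) (E : (nat -> T) -> Prop) : Prop :=
  forall tau, E tau -> forall G : nat -> Prop, enumerable G ->
    exists rho, E rho /\ (forall x, ~ G x -> rho x = tau x)
                      /\ (forall x, G x -> rho x <> bot).

Definition effectively_optimal {T : Type} (E : (nat -> T) -> Prop) (omega : nat -> T) : Prop :=
  E omega /\ forall mu, E mu ->
    exists h, total_computable h /\ length_bounded h /\ forall x, mu x = omega (h x).

(* Main.v *)
Require Import Defs.
From Stdlib Require Import List Arith PeanoNat Lia Bool Classical ClassicalDescription.
From Stdlib Require Cantor.
Import ListNotations.

(** Diagonalising against a universal program turns the length-bounded
    translations between [nu] and [nu'] into injective ones [g] and [g'].
    Take the codes of [nu'] and of [nu] as the vertices of a bipartite graph and let [s] be the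
    injection that applies [g] on one side and [g'] on the other. Group the vertices into levels
    by length, so that [s] raises the level by at most one. Cut into pieces by the level bound
    [n], each [s]-chain falls into finite blocks that are cycles or are left through a single
    exit of level [n + 1]. A block has as many vertices on either side, or becomes balanced when
    its exit is added, so matching block by block with increasing [n] pairs vertices whose
    levels differ by at most one. *)

(** * Recursive functions *)

(** A Cantor-Bernstein argument along whole [s]-chains is not effective, because it is not decidable
    in general whether a chain has a beginning and on which side. The usual back-and-forth is
    effective, but follows chains for unboundedly many steps, each of which may cost a constant in
    length. Below a level bound everything is finite, so the block of a vertex can be computed
    outright. As [s] swaps the sides, a block with an exit is an alternating path: its only possible
    imbalance is one vertex missing on the side of the exit, and the parity of its size decides
    whether the exit is matched with it. Completed blocks for [n] lie inside those for [n + 1], so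
    the vertices new at [n + 1] balance among themselves and earlier pairs are never revised. The
    diagonalisation gets by without the recursion theorem: a single enumeration serves all programs,
    each being spoiled on a slice of codes of its own. A slice is reached by a linear map, so
    passing to it keeps the length bound. *)

Section EvalpInduction.
Variables (P : prf -> list nat -> nat -> Prop) (Q : list prf -> list nat -> list nat -> Prop).
Hypothesis cZero : forall xs, P PZero xs 0.
Hypothesis cSucc : forall x xs, P PSucc (x :: xs) (S x).
Hypothesis cProj : forall i xs, i < length xs -> P (PProj i) xs (nth i xs 0).
Hypothesis cComp : forall f gs xs ys y, Q gs xs ys -> P f ys y -> P (PComp f gs) xs y.
Hypothesis cPrim0 : forall f g xs y, P f xs y -> P (PPrim f g) (0 :: xs) y.
Hypothesis cPrimS : forall f g n xs r y,
  P (PPrim f g) (n :: xs) r -> P g (n :: r :: xs) y -> P (PPrim f g) (S n :: xs) y.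
Hypothesis cMu : forall f xs n, P f (n :: xs) 0 ->
  (forall m, m < n -> exists z, z <> 0 /\ P f (m :: xs) z) -> P (PMu f) xs n.
Hypothesis cNil : forall xs, Q [] xs [].
Hypothesis cCons : forall g gs xs y ys, P g xs y -> Q gs xs ys -> Q (g :: gs) xs (y :: ys).

(* The scheme Rocq generates has no induction hypothesis under the existential of [eMu]. *)
Fixpoint evalp_nested_ind p xs y (H : evalp p xs y) {struct H} : P p xs y :=
  match H with
  | eZero xs => cZero xs
  | eSucc x xs => cSucc x xs
  | eProj i xs Hi => cProj i xs Hi
  | eComp f gs xs ys y Hgs Hf =>
      cComp _ _ _ _ _ (evals_nested_ind _ _ _ Hgs) (evalp_nested_ind _ _ _ Hf)
  | ePrim0 f g xs y Hf => cPrim0 _ _ _ _ (evalp_nested_ind _ _ _ Hf)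
  | ePrimS f g n xs r y Hr Hg =>
      cPrimS _ _ _ _ _ _ (evalp_nested_ind _ _ _ Hr) (evalp_nested_ind _ _ _ Hg)
  | eMu f xs n H0 Hm =>
      cMu _ _ _ (evalp_nested_ind _ _ _ H0)
        (fun m lt => match Hm m lt with
                     | ex_intro _ z (conj nz Hz) =>
                         ex_intro _ z (conj nz (evalp_nested_ind _ _ _ Hz))
                     end)
  end
with evals_nested_ind gs xs ys (H : evals gs xs ys) {struct H} : Q gs xs ys :=
  match H with
  | esNil xs => cNil xs
  | esCons g gs xs y ys Hg Hgs =>
      cCons _ _ _ _ _ (evalp_nested_ind _ _ _ Hg) (evals_nested_ind _ _ _ Hgs)
  end.
End EvalpInduction.

Lemma evalp_functional p xs y : evalp p xs y -> forall y', evalp p xs y' -> y = y'.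
Proof.
  revert p xs y.
  apply (evalp_nested_ind (fun p xs y => forall y', evalp p xs y' -> y = y')
           (fun gs xs ys => forall ys', evals gs xs ys' -> ys = ys')).
  - intros xs y' H; inversion H; auto.
  - intros x xs y' H; inversion H; auto.
  - intros i xs Hi y' H; inversion H; auto.
  - intros f gs xs ys y IHgs IHf y' H; inversion H; subst.
    apply IHf. erewrite IHgs; eauto.
  - intros f g xs y IH y' H; inversion H; subst; auto.
  - intros f g n xs r y IHr IHg y' H; inversion H; subst.
    apply IHg. erewrite IHr; eauto.
  - intros f xs n IH0 IHm n' H; inversion H as [| | | | | |? ? ? H0 Hm]; subst.
    destruct (lt_eq_lt_dec n n') as [[Hlt | ->] | Hlt]; auto; exfalso.
    + destruct (Hm _ Hlt) as (z & Hz & Hez). apply Hz. symmetry. apply IH0, Hez.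
    + destruct (IHm _ Hlt) as (z & Hz & Hez). apply Hz, Hez, H0.
  - intros xs ys' H; inversion H; auto.
  - intros g gs xs y ys IHg IHgs ys' H; inversion H; subst. f_equal; auto.
Qed.

Lemma evalp_eq p xs y y' : evalp p xs y -> y = y' -> evalp p xs y'.
Proof. now intros H <-. Qed.

Lemma evalp_proj i xs y : nth_error xs i = Some y -> evalp (PProj i) xs y.
Proof.
  intros H. rewrite <- (nth_error_nth xs i 0 H). constructor.
  apply nth_error_Some. congruence.
Qed.

Lemma evalp_mu p (q : nat -> nat) xs m :
  (forall i, evalp p (i :: xs) (q i)) -> q m = 0 -> (forall i, i < m -> q i <> 0) ->
  evalp (PMu p) xs m.
Proof.
  intros Hp H0 Hlt. constructor.
  - rewrite <- H0. apply Hp.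
  - intros i Hi. exists (q i). auto.
Qed.

(** * Closure properties of computable functions *)

Definition binary_computable (f : nat -> nat -> nat) : Prop :=
  exists p, forall a b, evalp p [a; b] (f a b).

Lemma total_computable_ext f g :
  (forall x, f x = g x) -> total_computable f -> total_computable g.
Proof. intros E [p Hp]. exists p. intros n. rewrite <- E. apply Hp. Qed.

Lemma computable_const c : total_computable (fun _ => c).
Proof.
  induction c as [|c [p Hp]].
  - exists PZero. constructor.
  - exists (PComp PSucc [p]). intros n. repeat econstructor. apply Hp.
Qed.

Lemma computable_id : total_computable (fun z => z).
Proof. exists (PProj 0). intros n. now apply evalp_proj. Qed.

Lemma computable_app f a :
  total_computable f -> total_computable a -> total_computable (fun z => f (a z)).
Proof.
  intros [p Hp] [q Hq]. exists (PComp p [q]). intros n.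
  econstructor; [repeat econstructor; apply Hq | apply Hp].
Qed.

Lemma computable_app2 f a b : binary_computable f ->
  total_computable a -> total_computable b -> total_computable (fun z => f (a z) (b z)).
Proof.
  intros [p Hp] [q Hq] [r Hr]. exists (PComp p [q; r]). intros n.
  econstructor; [repeat econstructor; [apply Hq | apply Hr] | apply Hp].
Qed.

Lemma computable_S a : total_computable a -> total_computable (fun z => S (a z)).
Proof. apply computable_app. exists PSucc. constructor. Qed.

Lemma binary_computable_add : binary_computable Nat.add.
Proof.
  exists (PPrim (PProj 0) (PComp PSucc [PProj 1])). intros a b.
  induction a; simpl; [constructor; now apply evalp_proj | econstructor; [eassumption|]].
  repeat (econstructor; try now apply evalp_proj).
Qed.

Lemma computable_add a b :
  total_computable a -> total_computable b -> total_computable (fun z => a z + b z).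
Proof. apply computable_app2, binary_computable_add. Qed.

Lemma computable_pred a : total_computable a -> total_computable (fun z => pred (a z)).
Proof.
  apply computable_app. exists (PPrim PZero (PProj 0)). intros n.
  induction n; simpl; [repeat constructor | econstructor; [eassumption|]].
  now apply evalp_proj.
Qed.

(** The subtrahend comes first because [PPrim] recurses on its first argument. *)
Lemma binary_computable_sub : binary_computable (fun x y => y - x).
Proof.
  destruct (computable_pred _ computable_id) as [p Hp].
  exists (PPrim (PProj 0) (PComp p [PProj 1])). intros x y.
  induction x.
  - rewrite Nat.sub_0_r. constructor. now apply evalp_proj.
  - econstructor; [eassumption|]. rewrite Nat.sub_succ_r.
    econstructor; [|apply Hp]. repeat (econstructor; try now apply evalp_proj).
Qed.

Lemma computable_sub a b :
  total_computable a -> total_computable b -> total_computable (fun z => a z - b z).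
Proof.
  intros Ha Hb. exact (computable_app2 (fun x y => y - x) _ _ binary_computable_sub Hb Ha).
Qed.

(** * Cantor pairing and its projections *)

Definition pairn (x y : nat) : nat := Cantor.to_nat (x, y).
Definition fstn (z : nat) : nat := fst (Cantor.of_nat z).
Definition sndn (z : nat) : nat := snd (Cantor.of_nat z).

Lemma fstn_pairn x y : fstn (pairn x y) = x.
Proof. unfold fstn, pairn. now rewrite Cantor.cancel_of_to. Qed.

Lemma sndn_pairn x y : sndn (pairn x y) = y.
Proof. unfold sndn, pairn. now rewrite Cantor.cancel_of_to. Qed.

Fixpoint triangle (n : nat) : nat :=
  match n with 0 => 0 | S m => triangle m + S m end.

Lemma triangle_mono m n : m <= n -> triangle m <= triangle n.
Proof. induction 1; simpl; lia. Qed.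

Lemma pairn_triangle x y : pairn x y = triangle (x + y) + y.
Proof.
  assert (H : forall n, triangle n * 2 = n * S n) by (induction n; simpl; lia).
  pose proof (Cantor.to_nat_spec x y) as E. pose proof (H (x + y)) as E'.
  unfold pairn. rewrite (Nat.add_comm y x) in E. lia.
Qed.

Lemma pairn_eta z : pairn (fstn z) (sndn z) = z.
Proof.
  unfold fstn, sndn, pairn. rewrite <- surjective_pairing. apply Cantor.cancel_to_of.
Qed.

Lemma computable_triangle a :
  total_computable a -> total_computable (fun z => triangle (a z)).
Proof.
  apply computable_app. destruct binary_computable_add as [p Hp].
  exists (PPrim PZero (PComp p [PProj 1; PComp PSucc [PProj 0]])). intros n.
  induction n; [repeat constructor | econstructor; [eassumption|]].
  simpl triangle. econstructor; [|apply Hp].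
  repeat (econstructor; try now apply evalp_proj).
Qed.

Lemma binary_computable_pairn : binary_computable pairn.
Proof.
  destruct binary_computable_add as [p Hp].
  destruct (computable_triangle _ computable_id) as [t Ht].
  exists (PComp p [PComp t [p]; PProj 1]). intros a b. rewrite pairn_triangle.
  econstructor; [|apply Hp].
  econstructor; [|econstructor; [|constructor]; now apply evalp_proj].
  econstructor; [|apply Ht]. econstructor; [apply Hp|constructor].
Qed.

Lemma computable_pairn a b :
  total_computable a -> total_computable b -> total_computable (fun z => pairn (a z) (b z)).
Proof. apply computable_app2, binary_computable_pairn. Qed.

(** The diagonal containing [z] is the least [i] with [z < triangle (S i)], that is, the first zero
    of the truncated difference [S z - triangle (S i)]. *)
Lemma computable_diagonal : total_computable (fun z => fstn z + sndn z).
Proof.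
  assert (Hq : total_computable (fun z => triangle (S z))).
  { apply computable_triangle, computable_S, computable_id. }
  destruct Hq as [t Ht].
  destruct binary_computable_sub as [p Hp].
  exists (PMu (PComp p [PComp t [PProj 0]; PComp PSucc [PProj 1]])). intros z.
  rewrite <- (pairn_eta z) at 1. generalize (fstn z) (sndn z). clear z. intros x y.
  apply evalp_mu with (q := fun i => S (pairn x y) - triangle (S i)).
  - intros i. econstructor; [|apply Hp].
    econstructor; [econstructor; [|apply Ht] | econstructor; [|constructor]].
    + econstructor; [now apply evalp_proj | constructor].
    + econstructor; [econstructor; [now apply evalp_proj | constructor] | constructor].
  - rewrite pairn_triangle. cbn [triangle]. lia.
  - intros i Hi. pose proof (triangle_mono (S i) (x + y) Hi). rewrite pairn_triangle. lia.
Qed.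

Lemma computable_sndn a : total_computable a -> total_computable (fun z => sndn (a z)).
Proof.
  apply computable_app.
  apply total_computable_ext with (fun z => z - triangle (fstn z + sndn z)).
  - intros z. rewrite <- (pairn_eta z) at 1. rewrite pairn_triangle. lia.
  - apply computable_sub; [apply computable_id|].
    apply computable_triangle, computable_diagonal.
Qed.

Lemma computable_fstn a : total_computable a -> total_computable (fun z => fstn (a z)).
Proof.
  apply computable_app.
  apply total_computable_ext with (fun z => (fstn z + sndn z) - sndn z); [intros; lia|].
  apply computable_sub; [apply computable_diagonal | apply computable_sndn, computable_id].
Qed.

Fixpoint natrec (a : nat) (f : nat -> nat -> nat) (n : nat) : nat :=
  match n with 0 => a | S m => f m (natrec a f m) end.

(** The step function takes its three arguments packed into one number, so that from here on
    essentially only unary computability has to be tracked. *)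
Lemma computable_natrec (a : nat -> nat) (f : nat -> nat -> nat -> nat) (n : nat -> nat) :
  total_computable a -> total_computable n ->
  total_computable (fun w => f (fstn w) (fstn (sndn w)) (sndn (sndn w))) ->
  total_computable (fun z => natrec (a z) (fun i r => f i r z) (n z)).
Proof.
  intros [pa Ha] Hn [pf Hf]. destruct binary_computable_pairn as [pp Hpp].
  apply (computable_app2 (fun n z => natrec (a z) (fun i r => f i r z) n));
    [|assumption|apply computable_id].
  exists (PPrim pa (PComp pf [PComp pp [PProj 0; PComp pp [PProj 1; PProj 2]]])).
  intros m z. induction m as [|m IH]; simpl.
  - constructor. apply Ha.
  - econstructor; [exact IH|].
    econstructor; [|eapply evalp_eq; [apply Hf | now rewrite !sndn_pairn, !fstn_pairn]].
    econstructor; [|constructor]. econstructor; [|apply Hpp].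
    econstructor; [now apply evalp_proj | econstructor; [|constructor]].
    econstructor; [|apply Hpp].
    repeat (econstructor; try now apply evalp_proj).
Qed.
(* Keeps unification from evaluating codes of programs. *)
Opaque pairn fstn sndn.

Definition computable_test (P : nat -> bool) : Prop :=
  total_computable (fun z => Nat.b2n (P z)).

Create HintDb comp.
Hint Resolve computable_const computable_id computable_S computable_add computable_pred
  computable_sub computable_pairn computable_fstn computable_sndn : comp.
Hint Resolve computable_natrec | 5 : comp.
Hint Extern 4 (total_computable (fun z => ?f (@?a z))) =>
  match goal with H : total_computable f |- _ => apply (computable_app f a H) end : comp.
Hint Extern 1 (total_computable ?f) =>
  match goal with H : total_computable f |- _ => exact H end : comp.

Lemma computable_mul a b :
  total_computable a -> total_computable b -> total_computable (fun z => a z * b z).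
Proof.
  intros Ha Hb.
  apply total_computable_ext with (fun z => natrec 0 (fun _ r => b z + r) (a z)).
  - intros z. induction (a z); simpl; auto.
  - apply (computable_natrec _ (fun i r z => b z + r)); auto with comp.
Qed.
Hint Resolve computable_mul : comp.

Lemma computable_pow a b :
  total_computable a -> total_computable b -> total_computable (fun z => a z ^ b z).
Proof.
  intros Ha Hb.
  apply total_computable_ext with (fun z => natrec 1 (fun _ r => a z * r) (b z)).
  - intros z. induction (b z); simpl; auto.
  - apply (computable_natrec _ (fun i r z => a z * r)); auto with comp.
Qed.
Hint Resolve computable_pow : comp.

Lemma computable_test_leb a b :
  total_computable a -> total_computable b -> computable_test (fun z => a z <=? b z).
Proof.
  intros Ha Hb. apply total_computable_ext with (fun z => 1 - (a z - b z)).
  - intros z. destruct (Nat.leb_spec (a z) (b z)); simpl Nat.b2n; lia.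
  - auto 10 with comp.
Qed.

Lemma computable_test_ltb a b :
  total_computable a -> total_computable b -> computable_test (fun z => a z <? b z).
Proof. intros. apply (computable_test_leb (fun z => S (a z))); auto with comp. Qed.

Lemma computable_test_eqb a b :
  total_computable a -> total_computable b -> computable_test (fun z => a z =? b z).
Proof.
  intros Ha Hb. apply total_computable_ext with (fun z => 1 - ((a z - b z) + (b z - a z))).
  - intros z. destruct (Nat.eqb_spec (a z) (b z)); simpl Nat.b2n; lia.
  - auto 10 with comp.
Qed.

Lemma computable_test_negb P : computable_test P -> computable_test (fun z => negb (P z)).
Proof.
  intros HP. apply total_computable_ext with (fun z => 1 - Nat.b2n (P z)).
  - intros z. now destruct (P z).
  - unfold computable_test in HP. auto with comp.
Qed.

Lemma computable_test_andb P Q : computable_test P -> computable_test Q ->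
  computable_test (fun z => P z && Q z).
Proof.
  intros HP HQ. apply total_computable_ext with (fun z => Nat.b2n (P z) * Nat.b2n (Q z)).
  - intros z. now destruct (P z), (Q z).
  - unfold computable_test in *. auto with comp.
Qed.

Lemma computable_test_odd a : total_computable a -> computable_test (fun z => Nat.odd (a z)).
Proof.
  intros Ha. apply total_computable_ext with (fun z => natrec 0 (fun _ r => 1 - r) (a z)).
  - intros z. induction (a z) as [|n IH]; [reflexivity|]. cbn [natrec].
    rewrite IH, Nat.odd_succ, <- Nat.negb_odd. now destruct (Nat.odd n).
  - apply (computable_natrec _ (fun i r z => 1 - r)); auto 10 with comp.
Qed.

Lemma computable_test_eqb_bool P Q : computable_test P -> computable_test Q ->
  computable_test (fun z => eqb (P z) (Q z)).
Proof.
  intros HP HQ.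
  apply total_computable_ext with (fun z => Nat.b2n (Nat.b2n (P z) =? Nat.b2n (Q z))).
  - intros z. now destruct (P z), (Q z).
  - apply computable_test_eqb; assumption.
Qed.

Lemma computable_b2n P : computable_test P -> total_computable (fun z => Nat.b2n (P z)).
Proof. trivial. Qed.

Hint Resolve computable_test_leb computable_test_ltb computable_test_eqb computable_test_negb
  computable_test_andb computable_test_odd computable_test_eqb_bool computable_b2n : comp.

Lemma computable_if P a b : computable_test P -> total_computable a -> total_computable b ->
  total_computable (fun z => if P z then a z else b z).
Proof.
  intros HP Ha Hb.
  apply total_computable_ext with (fun z => natrec (b z) (fun _ _ => a z) (Nat.b2n (P z))).
  - intros z. now destruct (P z).
  - apply (computable_natrec _ (fun i r z => a z)); auto 10 with comp.
Qed.
Hint Resolve computable_if : comp.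

Lemma computable_test_app2 (P : nat -> nat -> bool) a b :
  computable_test (fun w => P (fstn w) (sndn w)) ->
  total_computable a -> total_computable b -> computable_test (fun z => P (a z) (b z)).
Proof.
  intros HP Ha Hb. apply total_computable_ext with
    (fun z => (fun w => Nat.b2n (P (fstn w) (sndn w))) (pairn (a z) (b z))).
  - intros z. now rewrite fstn_pairn, sndn_pairn.
  - apply (computable_app _ _ HP). auto with comp.
Qed.

(** * Bounded counting and search *)

Definition count (P : nat -> bool) (n : nat) : nat :=
  natrec 0 (fun i r => Nat.b2n (P i) + r) n.

Lemma count_S P n : count P (S n) = Nat.b2n (P n) + count P n.
Proof. reflexivity. Qed.

Lemma computable_count (P : nat -> nat -> bool) n : total_computable n ->
  computable_test (fun w => P (fstn w) (sndn w)) ->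
  total_computable (fun z => count (fun i => P i z) (n z)).
Proof.
  intros Hn HP. apply (computable_natrec _ (fun i r z => Nat.b2n (P i z) + r)); auto with comp.
  apply computable_add; auto with comp. apply (computable_test_app2 P); auto 10 with comp.
Qed.
Hint Resolve computable_count : comp.

Definition exists_below (P : nat -> bool) (n : nat) : bool := negb (count P n =? 0).
Definition all_below (P : nat -> bool) (n : nat) : bool :=
  count (fun i => negb (P i)) n =? 0.
(** Counts the numbers that precede the first witness, which gives that witness itself, and the
    default [n] if there is none below [n]. *)
Definition least (P : nat -> bool) (n : nat) : nat :=
  count (fun i => negb (exists_below P (S i))) n.

Lemma computable_exists_below (P : nat -> nat -> bool) n : total_computable n ->
  computable_test (fun w => P (fstn w) (sndn w)) ->
  computable_test (fun z => exists_below (fun i => P i z) (n z)).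
Proof. unfold exists_below. auto with comp. Qed.

Lemma computable_all_below (P : nat -> nat -> bool) n : total_computable n ->
  computable_test (fun w => P (fstn w) (sndn w)) ->
  computable_test (fun z => all_below (fun i => P i z) (n z)).
Proof.
  intros Hn HP. unfold all_below. apply computable_test_eqb; auto with comp.
Qed.

Lemma computable_least (P : nat -> nat -> bool) n : total_computable n ->
  computable_test (fun w => P (fstn w) (sndn w)) ->
  total_computable (fun z => least (fun i => P i z) (n z)).
Proof.
  intros Hn HP. unfold least.
  apply (computable_count (fun i z => negb (exists_below (fun i => P i z) (S i))));
    auto with comp.
  apply computable_test_negb.
  apply (computable_exists_below (fun j w => P j (sndn w)) (fun w => S (fstn w)));
    auto with comp.
  apply (computable_test_app2 P); auto 10 with comp.
Qed.
Hint Resolve computable_exists_below computable_all_below computable_least : comp.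

Lemma count_zero P n : count P n = 0 <-> forall i, i < n -> P i = false.
Proof.
  induction n as [|n IH]; [split; auto; lia|]. rewrite count_S. split.
  - intros H i Hi. destruct (P n) eqn:E; simpl in H; [lia|].
    destruct (Nat.eq_dec i n) as [->|]; auto. apply IH; lia.
  - intros H. rewrite (H n) by lia. apply IH. intros i Hi. apply H; lia.
Qed.

Lemma exists_below_true P n : exists_below P n = true <-> exists i, i < n /\ P i = true.
Proof.
  unfold exists_below. rewrite negb_true_iff, Nat.eqb_neq, count_zero. split.
  - intros H. apply NNPP. intros H'. apply H. intros i Hi. apply not_true_is_false.
    intros HP. apply H'. now exists i.
  - intros (i & Hi & HP) H. specialize (H i Hi). congruence.
Qed.

Lemma all_below_true P n : all_below P n = true <-> forall i, i < n -> P i = true.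
Proof.
  unfold all_below. rewrite Nat.eqb_eq, count_zero. split; intros H i Hi.
  - now apply negb_false_iff, H.
  - now apply negb_false_iff, H.
Qed.

Lemma count_le P n : count P n <= n.
Proof. induction n; [auto|]. rewrite count_S. destruct (P n); simpl; lia. Qed.

Lemma count_ext P Q n : (forall i, i < n -> P i = Q i) -> count P n = count Q n.
Proof.
  induction n as [|n IH]; intros H; auto. rewrite !count_S, IH, H by auto; auto.
Qed.

Lemma least_prop P n i : i < n -> P i = true ->
  P (least P n) = true /\ least P n <= i.
Proof.
  intros Hi HP.
  assert (Hm : exists m, P m = true /\ forall j, j < m -> P j = false).
  { induction i as [i IH] using lt_wf_ind.
    destruct (classic (exists j, j < i /\ P j = true)) as [(j & Hj & HPj)|Hn].
    - apply (IH j); auto; lia.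
    - exists i. split; auto. intros j Hj. apply not_true_is_false. eauto. }
  destruct Hm as (m & Hm & Hlt).
  assert (Hmi : m <= i).
  { apply Nat.nlt_ge. intros Hc. rewrite Hlt in HP; congruence. }
  assert (E : forall k, least P k = Nat.min k m).
  { induction k as [|k IH]; auto. unfold least in *. rewrite count_S, IH.
    destruct (exists_below P (S k)) eqn:Ex; simpl Nat.b2n.
    - apply exists_below_true in Ex. destruct Ex as (j & Hj & HPj).
      assert (m <= j) by (apply Nat.nlt_ge; intros Hc; rewrite Hlt in HPj; congruence). lia.
    - assert (~ m < S k); [|lia]. intros Hc.
      assert (exists_below P (S k) = true) by (apply exists_below_true; eauto). congruence. }
  rewrite E, Nat.min_r by lia. auto.
Qed.

Lemma least_ext P Q n : (forall i, i < n -> P i = Q i) -> least P n = least Q n.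
Proof.
  intros H. apply count_ext. intros i Hi. f_equal. unfold exists_below.
  do 2 f_equal. apply count_ext. intros j Hj. apply H. lia.
Qed.

(** * A universal program *)

(** An intermediate language without arities: a program acts on a single number, and one loop
    construct serves both [PPrim] and [PMu], so a simple stack machine can run it. *)
Inductive wprog : Type :=
| WZero | WSucc | WPred | WFst | WSnd
| WPair (f g : wprog)
| WComp (f g : wprog)
| WWhile (f : wprog).

Inductive weval : wprog -> nat -> nat -> Prop :=
| wevZero v : weval WZero v 0
| wevSucc v : weval WSucc v (S v)
| wevPred v : weval WPred v (pred v)
| wevFst v : weval WFst v (fstn v)
| wevSnd v : weval WSnd v (sndn v)
| wevPair f g v y z : weval f v y -> weval g v z -> weval (WPair f g) v (pairn y z)
| wevComp f g v u y : weval g v u -> weval f u y -> weval (WComp f g) v y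
| wevStop f v : fstn v = 0 -> weval (WWhile f) v v
| wevLoop f v u y :
    fstn v <> 0 -> weval f v u -> weval (WWhile f) u y -> weval (WWhile f) v y.

Lemma weval_eq f v y y' : weval f v y -> y = y' -> weval f v y'.
Proof. now intros H <-. Qed.

Fixpoint list_code (xs : list nat) : nat :=
  match xs with [] => 0 | x :: xs => pairn x (list_code xs) end.

Fixpoint wproj (i : nat) : wprog :=
  match i with 0 => WFst | S i => WComp (wproj i) WSnd end.

Definition wid : wprog := WPair WFst WSnd.

(* State [<k, <i, <r, x>>>]: [k] iterations left, [i] done, current value [r]. *)
Definition prim_body (g : wprog) : wprog :=
  WPair (WComp WPred WFst)
    (WPair (WComp WSucc (wproj 1)) (WPair (WComp g WSnd) (WComp WSnd (WComp WSnd WSnd)))).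

(** State [<y, <i, x>>], where [y] is the value of [f] at the candidate [i]. With [y] in front, the
    loop stops at the first zero. *)
Definition mu_body (f : wprog) : wprog :=
  let next := WPair (WComp WSucc (wproj 1)) (WComp WSnd WSnd) in
  WPair (WComp f next) next.

Fixpoint translate (p : prf) : wprog :=
  match p with
  | PZero => WZero
  | PSucc => WComp WSucc WFst
  | PProj i => wproj i
  | PComp f gs =>
      WComp (translate f)
        ((fix translate_list gs :=
            match gs with
            | [] => WZero
            | g :: gs => WPair (translate g) (translate_list gs)
            end) gs)
  | PPrim f g =>
      WComp (wproj 2)
        (WComp (WWhile (prim_body (translate g)))
           (WPair WFst (WPair WZero (WPair (WComp (translate f) WSnd) WSnd))))
  | PMu f =>
      let init := WPair WZero wid in
      WComp (wproj 1)
        (WComp (WWhile (mu_body (translate f))) (WPair (WComp (translate f) init) init))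
  end.

(** Convertible to the inner [fix] of [translate]; it gives the induction over argument lists a name
    to speak of. *)
Fixpoint translate_list (gs : list prf) : wprog :=
  match gs with
  | [] => WZero
  | g :: gs => WPair (translate g) (translate_list gs)
  end.

Lemma weval_proj i xs : i < length xs -> weval (wproj i) (list_code xs) (nth i xs 0).
Proof.
  revert xs. induction i as [|i IH]; intros [|x xs] H; simpl in H; try lia; simpl.
  - eapply weval_eq; [constructor | apply fstn_pairn].
  - econstructor; [constructor|]. rewrite sndn_pairn. apply IH. lia.
Qed.

(** [weval] peels off the first iteration of a loop, whereas recursion and minimisation supply the
    last one; this relation grows at the end. *)
Inductive wloop (f : wprog) : nat -> nat -> Prop :=
| wloop_refl v : wloop f v v
| wloop_step v u w : wloop f v u -> fstn u <> 0 -> weval f u w -> wloop f v w.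

Lemma weval_while f v u : wloop f v u -> fstn u = 0 -> weval (WWhile f) v u.
Proof.
  intros H H0. enough (forall y, weval (WWhile f) u y -> weval (WWhile f) v y) as E
    by (apply E; now constructor).
  clear H0. induction H; auto. intros y Hy. apply IHwloop. econstructor; eauto.
Qed.

Lemma weval_wid v : weval wid v v.
Proof. eapply weval_eq; [repeat constructor | apply pairn_eta]. Qed.

Lemma weval_prim_body g k i r x y : weval g (pairn i (pairn r x)) y ->
  weval (prim_body g) (pairn (S k) (pairn i (pairn r x))) (pairn k (pairn (S i) (pairn y x))).
Proof.
  intros Hg. eapply weval_eq.
  - repeat econstructor. rewrite sndn_pairn. exact Hg.
  - now repeat rewrite ?fstn_pairn, ?sndn_pairn.
Qed.

Lemma weval_mu_body f c i x y : weval f (pairn (S i) x) y ->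
  weval (mu_body f) (pairn c (pairn i x)) (pairn y (pairn (S i) x)).
Proof.
  intros Hf.
  assert (Hn : weval (WPair (WComp WSucc (wproj 1)) (WComp WSnd WSnd))
                 (pairn c (pairn i x)) (pairn (S i) x)).
  { eapply weval_eq; [repeat econstructor|]. now repeat rewrite ?fstn_pairn, ?sndn_pairn. }
  unfold mu_body. econstructor; [|exact Hn]. econstructor; eassumption.
Qed.

(* For primitive recursion the induction needs the intermediate states of the loop, run with
   an arbitrary number [j] of iterations left over. *)
Definition translate_spec (p : prf) (xs : list nat) (y : nat) : Prop :=
  match p, xs with
  | PPrim f g, n :: xs =>
      exists y0, weval (translate f) (list_code xs) y0 /\
      forall j, wloop (prim_body (translate g))
        (pairn (n + j) (pairn 0 (pairn y0 (list_code xs))))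
        (pairn j (pairn n (pairn y (list_code xs))))
  | PPrim f g, [] => True
  | _, _ => weval (translate p) (list_code xs) y
  end.

Lemma translate_spec_weval p xs y : evalp p xs y ->
  translate_spec p xs y -> weval (translate p) (list_code xs) y.
Proof.
  intros He. destruct p as [| | | |f g|]; auto. destruct xs as [|n xs]; [inversion He|].
  intros (y0 & H0 & Hl). specialize (Hl 0). rewrite Nat.add_0_r in Hl.
  simpl. econstructor.
  - econstructor.
    + econstructor; [constructor|].
      econstructor; [constructor|]. econstructor; [|constructor].
      econstructor; [constructor|]. rewrite sndn_pairn. eassumption.
    + rewrite fstn_pairn, sndn_pairn. apply weval_while; [exact Hl|]. apply fstn_pairn.
  - eapply weval_eq; [repeat econstructor|]. now repeat rewrite ?fstn_pairn, ?sndn_pairn.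
Qed.

Lemma translate_correct p xs y : evalp p xs y -> weval (translate p) (list_code xs) y.
Proof.
  intros He. apply translate_spec_weval; [assumption|].
  enough (H : evalp p xs y /\ translate_spec p xs y) by apply H. revert p xs y He.
  apply (evalp_nested_ind (fun p xs y => evalp p xs y /\ translate_spec p xs y)
           (fun gs xs ys => evals gs xs ys /\
              weval (translate_list gs) (list_code xs) (list_code ys))).
  - intros xs; split; constructor.
  - intros x xs; split; [constructor|].
    simpl. econstructor; [constructor|]. rewrite fstn_pairn. constructor.
  - intros i xs Hi; split; [now constructor | now apply weval_proj].
  - intros f gs xs ys y [Egs Hgs] [Ef Hf]; split; [econstructor; eauto|].
    econstructor; [exact Hgs | now apply translate_spec_weval].
  - intros f g xs y [Ef Hf]; split; [now constructor|].
    exists y. split; [now apply translate_spec_weval | constructor].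
  - intros f g n xs r y [Er (y0 & H0 & Hl)] [Eg Hg]; split; [econstructor; eauto|].
    exists y0. split; [exact H0|]. intros j. econstructor.
    + rewrite Nat.add_succ_comm. apply (Hl (S j)).
    + rewrite fstn_pairn. discriminate.
    + apply weval_prim_body. now apply translate_spec_weval in Hg.
  - intros f xs n [E0 H0] Hm; split.
    { constructor; [exact E0|]. intros m Hlt. destruct (Hm m Hlt) as (z & nz & Hz & _); eauto. }
    apply translate_spec_weval in H0; auto.
    (* Nonzero values, and hence further iterations, are known only for candidates below [n], so the
       induction over the loop stays within [m <= n]. *)
    assert (Hl : forall m y, m <= n -> weval (translate f) (list_code (m :: xs)) y ->
      exists y0, weval (translate f) (list_code (0 :: xs)) y0 /\
      wloop (mu_body (translate f)) (pairn y0 (pairn 0 (list_code xs)))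
        (pairn y (pairn m (list_code xs)))).
    { induction m as [|m IH]; intros y Hmn Hy.
      - exists y. split; [exact Hy | constructor].
      - destruct (Hm m Hmn) as (z & nz & Ez & Hz). apply translate_spec_weval in Hz; auto.
        destruct (IH z) as (y0 & Hy0 & Hl); [lia | exact Hz |].
        exists y0. split; [exact Hy0|]. econstructor; [exact Hl | now rewrite fstn_pairn |].
        now apply weval_mu_body. }
    destruct (Hl n 0 (le_n n) H0) as (y0 & Hy0 & Hloop).
    assert (Hi : weval (WPair WZero wid) (list_code xs) (list_code (0 :: xs)))
      by (constructor; [constructor | apply weval_wid]).
    simpl. econstructor; [econstructor|].
    + econstructor; [econstructor; [exact Hi | exact Hy0] | exact Hi].
    + apply weval_while; [exact Hloop | apply fstn_pairn].
    + eapply weval_eq; [repeat econstructor|]. now repeat rewrite ?fstn_pairn, ?sndn_pairn.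
  - intros xs; split; constructor.
  - intros g gs xs y ys [Eg Hg] [Egs Hgs]; split; [now constructor|].
    simpl. constructor; [now apply translate_spec_weval | exact Hgs].
Qed.

(** Stacks, unlike argument lists, must be tested for emptiness: the successor reserves [0] for the
    empty one, and an empty control stack means that the machine has halted. *)
Definition consn (a l : nat) : nat := S (pairn a l).
Definition hdn (l : nat) : nat := fstn (pred l).
Definition tln (l : nat) : nat := sndn (pred l).

Lemma hdn_consn a l : hdn (consn a l) = a.
Proof. apply fstn_pairn. Qed.

Lemma tln_consn a l : tln (consn a l) = l.
Proof. apply sndn_pairn. Qed.

Fixpoint wcode (f : wprog) : nat :=
  match f with
  | WZero => pairn 0 0
  | WSucc => pairn 1 0
  | WPred => pairn 2 0
  | WFst => pairn 3 0
  | WSnd => pairn 4 0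
  | WPair f g => pairn 5 (pairn (wcode f) (wcode g))
  | WComp f g => pairn 6 (pairn (wcode f) (wcode g))
  | WWhile f => pairn 7 (wcode f)
  end.

(* Executes the instruction with tag [t] and argument [a] on the remaining control stack [K]
   and the data stack [D]. Tags 0-7 are program codes; tags 8, 9, 10 are the auxiliary
   instructions dup, swap and pair on the data stack. *)
Definition exec (t a K D : nat) : nat :=
  if t =? 0 then pairn K (consn 0 (tln D))
  else if t =? 1 then pairn K (consn (S (hdn D)) (tln D))
  else if t =? 2 then pairn K (consn (pred (hdn D)) (tln D))
  else if t =? 3 then pairn K (consn (fstn (hdn D)) (tln D))
  else if t =? 4 then pairn K (consn (sndn (hdn D)) (tln D))
  else if t =? 5 then
    pairn (consn (pairn 8 0) (consn (fstn a) (consn (pairn 9 0)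
      (consn (sndn a) (consn (pairn 10 0) K))))) D
  else if t =? 6 then pairn (consn (sndn a) (consn (fstn a) K)) D
  else if t =? 7 then
    if fstn (hdn D) =? 0 then pairn K D else pairn (consn a (consn (pairn 7 a) K)) D
  else if t =? 8 then pairn K (consn (hdn D) D)
  else if t =? 9 then pairn K (consn (hdn (tln D)) (consn (hdn D) (tln (tln D))))
  else pairn K (consn (pairn (hdn (tln D)) (hdn D)) (tln (tln D))).

Definition step (st : nat) : nat :=
  if fstn st =? 0 then st
  else exec (fstn (hdn (fstn st))) (sndn (hdn (fstn st))) (tln (fstn st)) (sndn st).

Definition run (st n : nat) : nat := natrec st (fun _ r => step r) n.

Lemma computable_consn a b :
  total_computable a -> total_computable b -> total_computable (fun z => consn (a z) (b z)).
Proof. unfold consn. auto with comp. Qed.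

Lemma computable_hdn a : total_computable a -> total_computable (fun z => hdn (a z)).
Proof. unfold hdn. auto with comp. Qed.

Lemma computable_tln a : total_computable a -> total_computable (fun z => tln (a z)).
Proof. unfold tln. auto with comp. Qed.
Hint Resolve computable_consn computable_hdn computable_tln : comp.

Lemma computable_exec t a K D :
  total_computable t -> total_computable a -> total_computable K -> total_computable D ->
  total_computable (fun z => exec (t z) (a z) (K z) (D z)).
Proof. intros. unfold exec. auto 40 with comp. Qed.
Hint Resolve computable_exec : comp.

Lemma computable_step a : total_computable a -> total_computable (fun z => step (a z)).
Proof. intros. unfold step. auto 20 with comp. Qed.
Hint Resolve computable_step : comp.

Lemma computable_run a n : total_computable a -> total_computable n ->
  total_computable (fun z => run (a z) (n z)).
Proof. intros. apply (computable_natrec _ (fun i r z => step r)); auto 10 with comp. Qed.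
Hint Resolve computable_run : comp.

Lemma run_add st m n : run st (n + m) = run (run st m) n.
Proof. induction n; simpl; auto. unfold run in *. simpl. now rewrite IHn. Qed.

Lemma run_halted st n : fstn st = 0 -> run st n = st.
Proof.
  intros H. induction n; auto. unfold run in *. simpl. rewrite IHn. unfold step. now rewrite H.
Qed.

Definition reaches (st st' : nat) : Prop := exists n, run st n = st'.

Lemma reaches_trans st1 st2 st3 : reaches st1 st2 -> reaches st2 st3 -> reaches st1 st3.
Proof. intros [m Hm] [n Hn]. exists (n + m). now rewrite run_add, Hm. Qed.

Lemma reaches_exec t a K D st :
  reaches (exec t a K D) st -> reaches (pairn (consn (pairn t a) K) D) st.
Proof.
  apply reaches_trans. exists 1. unfold run. simpl. unfold step.
  now rewrite !fstn_pairn, sndn_pairn, !hdn_consn, tln_consn, fstn_pairn, sndn_pairn.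
Qed.

(** Arbitrary remainders [K] and [D] of the two stacks allow the runs of subprograms to be joined
    inside a longer run. *)
Lemma reaches_weval f v y : weval f v y -> forall K D,
  reaches (pairn (consn (wcode f) K) (consn v D)) (pairn K (consn y D)).
Proof.
  induction 1; intros K D; simpl wcode; apply reaches_exec; unfold exec; simpl Nat.eqb; cbv iota;
    rewrite ?hdn_consn, ?tln_consn, ?fstn_pairn, ?sndn_pairn;
    try (exists 0; reflexivity).
  - apply reaches_exec. unfold exec; simpl Nat.eqb; cbv iota. rewrite hdn_consn.
    eapply reaches_trans; [apply IHweval1|].
    apply reaches_exec. unfold exec; simpl Nat.eqb; cbv iota.
    rewrite ?hdn_consn, ?tln_consn, ?hdn_consn, ?tln_consn.
    eapply reaches_trans; [apply IHweval2|].
    apply reaches_exec. unfold exec; simpl Nat.eqb; cbv iota.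
    rewrite ?hdn_consn, ?tln_consn, ?hdn_consn, ?tln_consn.
    exists 0; reflexivity.
  - eapply reaches_trans; [apply IHweval1 | apply IHweval2].
  - rewrite H. exists 0. reflexivity.
  - apply Nat.eqb_neq in H. rewrite H.
    eapply reaches_trans; [apply IHweval1 | apply IHweval2].
Qed.

(* [universal e x n] is [0] while program [e] has not halted on [x] within [n] steps, and
   the successor of its value afterwards. *)
Definition universal (e x n : nat) : nat :=
  let st := run (pairn (consn e 0) (consn x 0)) n in
  if fstn st =? 0 then S (hdn (sndn st)) else 0.

Lemma computable_universal e x n :
  total_computable e -> total_computable x -> total_computable n ->
  total_computable (fun z => universal (e z) (x z) (n z)).
Proof. intros. unfold universal. cbv zeta. auto 20 with comp. Qed.
Hint Resolve computable_universal : comp.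

Lemma universal_stable e x m n : m <= n -> universal e x m <> 0 ->
  universal e x n = universal e x m.
Proof.
  unfold universal. intros Hmn. replace n with ((n - m) + m) by lia. rewrite run_add.
  destruct (Nat.eqb_spec (fstn (run (pairn (consn e 0) (consn x 0)) m)) 0) as [E|]; [|easy].
  intros _. rewrite run_halted by exact E. now rewrite E.
Qed.

Lemma universal_complete h : total_computable h ->
  exists e, forall x, exists n, universal e x n = S (h x).
Proof.
  intros [p Hp]. exists (wcode (WComp (translate p) (WPair wid WZero))). intros x.
  assert (H : weval (WComp (translate p) (WPair wid WZero)) x (h x)).
  { econstructor; [econstructor; [apply weval_wid | constructor]|].
    apply (translate_correct p [x]), Hp. }
  destruct (reaches_weval _ _ _ H 0 0) as [n Hn]. exists n.
  unfold universal. rewrite Hn, fstn_pairn, sndn_pairn, hdn_consn. reflexivity.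
Qed.

Lemma universal_sound e x n v : universal e x n <> 0 ->
  (exists m, universal e x m = S v) -> universal e x n = S v.
Proof.
  intros Hn [m Hm]. destruct (Nat.le_ge_cases m n) as [H|H].
  - rewrite (universal_stable e x m n H); congruence.
  - rewrite <- (universal_stable e x n m H); assumption.
Qed.

Lemma universal_uniform e h k : (forall x, exists n, universal e x n = S (h x)) ->
  exists n, forall x, x < k -> universal e x n = S (h x).
Proof.
  intros H. induction k as [|k [n Hn]]; [exists 0; lia|].
  destruct (H k) as [m Hm]. exists (m + n). intros x Hx.
  destruct (Nat.eq_dec x k) as [->|].
  - rewrite (universal_stable _ _ m); [auto | lia | rewrite Hm; discriminate].
  - assert (Hxk : x < k) by lia. specialize (Hn x Hxk).
    rewrite (universal_stable _ _ n); [auto | lia | rewrite Hn; discriminate].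
Qed.

(** * Injective translations *)

Lemma search_program (Q : nat -> nat -> bool) :
  computable_test (fun w => Q (fstn w) (sndn w)) ->
  exists p, forall d, (exists n, evalp p [d] n) <-> exists s, Q d s = true.
Proof.
  intros HQ. destruct (computable_test_negb _ HQ) as [q Hq].
  destruct binary_computable_pairn as [pp Hpp].
  (* [PMu] puts the search variable in front, so the arguments are swapped before pairing. *)
  set (g := PComp q [PComp pp [PProj 1; PProj 0]]).
  assert (Hg : forall s d, evalp g [s; d] (Nat.b2n (negb (Q d s)))).
  { intros s d. econstructor.
    - econstructor; [|constructor]. econstructor; [|apply Hpp].
      repeat (econstructor; try now apply evalp_proj).
    - eapply evalp_eq; [apply Hq|]. now rewrite fstn_pairn, sndn_pairn. }
  exists (PMu g). intros d. split.
  - intros [n Hn]. exists n. inversion Hn as [| | | | | |? ? ? H0 _]; subst.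
    pose proof (evalp_functional _ _ _ (Hg n d) _ H0) as E. now destruct (Q d n).
  - intros [s Hs]. exists (least (Q d) (S s)).
    apply evalp_mu with (q := fun s => Nat.b2n (negb (Q d s))); [auto| |].
    + now rewrite (proj1 (least_prop (Q d) (S s) s (le_n _) Hs)).
    + intros i Hi E. assert (HQi : Q d i = true) by now destruct (Q d i).
      destruct (least_prop (Q d) (S s) i) as [_ Hle]; auto; [|lia].
      pose proof (least_prop (Q d) (S s) s (le_n _) Hs). lia.
Qed.

Lemma enumerable_search (Q : nat -> nat -> bool) :
  computable_test (fun w => Q (fstn w) (sndn w)) -> enumerable (fun d => exists s, Q d s = true).
Proof.
  intros HQ. destruct (search_program Q HQ) as [p Hp]. exists p. intros d. now rewrite Hp.
Qed.

Lemma partial_computable_search (Q : nat -> nat -> bool) r (f : nat -> option nat) :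
  computable_test (fun w => Q (fstn w) (sndn w)) -> total_computable r ->
  (forall d y, f d = Some y <-> y = r d /\ exists s, Q d s = true) -> partial_computable f.
Proof.
  intros HQ [pr Hr] Hf. destruct (search_program Q HQ) as [p Hp].
  (* The search [p] is run only for its termination; [PProj 0] keeps the value of [r] and drops what
     the search found. *)
  exists (PComp (PProj 0) [pr; p]). intros d y. rewrite Hf, <- Hp. split.
  - intros H. inversion H as [| | |? ? ? ys ? Hs H0| | |]; subst.
    inversion Hs as [|? ? ? y1 ys1 H1 Hs1]; subst.
    inversion Hs1 as [|? ? ? y2 ys2 H2 Hs2]; subst.
    inversion H0; subst. split; [|eauto]. exact (evalp_functional _ _ _ H1 _ (Hr d)).
  - intros [-> [n Hn]]. econstructor; [repeat econstructor; [apply Hr | exact Hn]|].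
    now apply evalp_proj.
Qed.

(** [Nat.log2] rounds by less than one bit, whence the factor [2 ^ S c]; conversely [b < 2 ^ b], so
    [b] additional bits suffice. *)
Lemma length_bounded_iff_linear h :
  length_bounded h <-> exists b, forall x, S (h x) <= b * S x.
Proof.
  unfold length_bounded, blen. split.
  - intros [c Hc]. exists (2 ^ S c). intros x.
    destruct (Nat.log2_spec (S (h x))) as [_ Hh]; [lia|].
    destruct (Nat.log2_spec (S x)) as [Hx _]; [lia|].
    assert (2 ^ S (Nat.log2 (S (h x))) <= 2 ^ (Nat.log2 (S x) + S c)).
    { apply Nat.pow_le_mono_r; [lia|]. specialize (Hc x). lia. }
    rewrite Nat.pow_add_r in H. nia.
  - intros [b Hb]. exists b. intros x.
    rewrite Nat.add_comm, <- Nat.log2_mul_pow2 by lia. apply Nat.log2_le_mono.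
    specialize (Hb x). assert (b < 2 ^ b) by (apply Nat.pow_gt_lin_r; lia). nia.
Qed.

(* Unlike Cantor's pairing, this one is linear in [x] for fixed [e]. *)
Definition slice (e x : nat) : nat := pred (2 ^ e * (2 * x + 1)).
Definition slice_index (d : nat) : nat :=
  least (fun e => exists_below (fun x => slice e x =? d) (S d)) (S d).
Definition slice_arg (d : nat) : nat := least (fun x => slice (slice_index d) x =? d) (S d).

Lemma S_slice e x : S (slice e x) = 2 ^ e * (2 * x + 1).
Proof. unfold slice. pose proof (Nat.pow_nonzero 2 e). nia. Qed.

Lemma slice_inj e x e' x' : slice e x = slice e' x' -> e = e' /\ x = x'.
Proof.
  intros H. apply (f_equal S) in H. rewrite !S_slice in H. revert e' H.
  induction e as [|e IH]; intros [|e'] H; simpl Nat.pow in H; try lia.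
  destruct (IH e'); [nia|auto].
Qed.

Lemma slice_bounds e x : e <= slice e x /\ x <= slice e x.
Proof.
  pose proof (S_slice e x). assert (e < 2 ^ e) by (apply Nat.pow_gt_lin_r; lia). nia.
Qed.

Lemma slice_index_slice e x : slice_index (slice e x) = e.
Proof.
  unfold slice_index. set (P := fun e' => exists_below _ _). pose proof (slice_bounds e x).
  destruct (least_prop P (S (slice e x)) e) as [H1 _]; [lia| |].
  - apply exists_below_true. exists x. rewrite Nat.eqb_refl. split; [lia|reflexivity].
  - apply exists_below_true in H1. destruct H1 as (x' & _ & H1). apply Nat.eqb_eq in H1.
    now apply slice_inj in H1.
Qed.

Lemma slice_arg_slice e x : slice_arg (slice e x) = x.
Proof.
  unfold slice_arg. rewrite slice_index_slice. pose proof (slice_bounds e x).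
  destruct (least_prop (fun x' => slice e x' =? slice e x) (S (slice e x)) x) as [H1 _];
    [lia | apply Nat.eqb_refl |].
  apply Nat.eqb_eq in H1. now apply slice_inj in H1.
Qed.

Lemma computable_slice e x : total_computable e -> total_computable x ->
  total_computable (fun z => slice (e z) (x z)).
Proof. intros. unfold slice. auto 10 with comp. Qed.
Hint Resolve computable_slice : comp.

Lemma computable_slice_index d : total_computable d ->
  total_computable (fun z => slice_index (d z)).
Proof.
  intros. unfold slice_index.
  apply (computable_least (fun e z => exists_below (fun x => slice e x =? d z) (S (d z))));
    auto with comp.
  apply (computable_exists_below (fun x w => slice (fstn w) x =? d (sndn w))
           (fun w => S (d (sndn w)))); auto 10 with comp.
Qed.
Hint Resolve computable_slice_index : comp.

Lemma computable_slice_arg d : total_computable d ->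
  total_computable (fun z => slice_arg (d z)).
Proof.
  intros. unfold slice_arg.
  apply (computable_least (fun x z => slice (slice_index (d z)) x =? d z)); auto 10 with comp.
Qed.
Hint Resolve computable_slice_arg : comp.

(** The value [0] of [universal] means that no result is known yet, and two such zeros would pass
    for a collision; comparing values at time [s] makes sense only once this test succeeds. *)
Definition slice_halts (e k s : nat) : bool :=
  all_below (fun i => negb (universal e (slice e i) s =? 0)) (S k).

Definition slice_fresh (e x s : nat) : bool :=
  all_below (fun i => negb (universal e (slice e i) s =? universal e (slice e x) s)) x.

Definition noncolliding (d s : nat) : bool :=
  slice_halts (slice_index d) (slice_arg d) s && slice_fresh (slice_index d) (slice_arg d) s.

(** [w] packs the later argument [v] and a time [s], so that a single unbounded search suffices.
    Halting up to [v] includes [x], because [x < v]. *)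
Definition first_of_collision (d w : nat) : bool :=
  let e := slice_index d in let x := slice_arg d in
  let v := fstn w in let s := sndn w in
  (x <? v) && (slice_halts e v s && (slice_fresh e x s &&
    (universal e (slice e v) s =? universal e (slice e x) s))).

Lemma computable_slice_halts e k s :
  total_computable e -> total_computable k -> total_computable s ->
  computable_test (fun z => slice_halts (e z) (k z) (s z)).
Proof.
  intros. unfold slice_halts.
  apply (computable_all_below
           (fun i z => negb (universal (e z) (slice (e z) i) (s z) =? 0))); auto 20 with comp.
Qed.

Lemma computable_slice_fresh e x s :
  total_computable e -> total_computable x -> total_computable s ->
  computable_test (fun z => slice_fresh (e z) (x z) (s z)).
Proof.
  intros. unfold slice_fresh.
  apply (computable_all_below (fun i z => negb (universal (e z) (slice (e z) i) (s z) =?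
           universal (e z) (slice (e z) (x z)) (s z)))); auto 20 with comp.
Qed.
Hint Resolve computable_slice_halts computable_slice_fresh : comp.

Lemma computable_noncolliding :
  computable_test (fun w => noncolliding (fstn w) (sndn w)).
Proof. unfold noncolliding. auto 20 with comp. Qed.

Lemma computable_first_of_collision :
  computable_test (fun w => first_of_collision (fstn w) (sndn w)).
Proof. unfold first_of_collision. cbv zeta. auto 20 with comp. Qed.

Lemma noncolliding_slice e x s : noncolliding (slice e x) s = true <->
  (forall i, i <= x -> universal e (slice e i) s <> 0) /\
  (forall i, i < x -> universal e (slice e i) s <> universal e (slice e x) s).
Proof.
  unfold noncolliding, slice_halts, slice_fresh.
  rewrite slice_index_slice, slice_arg_slice, andb_true_iff, !all_below_true.
  setoid_rewrite negb_true_iff. setoid_rewrite Nat.eqb_neq. setoid_rewrite Nat.lt_succ_r.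
  reflexivity.
Qed.

Lemma first_of_collision_slice e x w : first_of_collision (slice e x) w = true <->
  x < fstn w /\
  (forall i, i <= fstn w -> universal e (slice e i) (sndn w) <> 0) /\
  (forall i, i < x -> universal e (slice e i) (sndn w) <> universal e (slice e x) (sndn w)) /\
  universal e (slice e (fstn w)) (sndn w) = universal e (slice e x) (sndn w).
Proof.
  unfold first_of_collision, slice_halts, slice_fresh.
  rewrite slice_index_slice, slice_arg_slice. cbv zeta.
  rewrite !andb_true_iff, !all_below_true, Nat.ltb_lt, Nat.eqb_eq.
  setoid_rewrite negb_true_iff. setoid_rewrite Nat.eqb_neq. setoid_rewrite Nat.lt_succ_r.
  reflexivity.
Qed.

(* The enumeration translated is [tau] spread over the slices [slice e], spoiled by [e] itself:
   as soon as program [e] gives two elements of its slice the same value, the later one is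
   sent to [bot] and the first one away from [bot]. If [e] computes a translation of this very
   enumeration, it cannot collide on its slice, so the slice carries [tau] unspoiled. *)
Lemma injective_translation {T : Type} (bot : T) (E : (nat -> T) -> Prop)
  (H1 : enum_axiom1 bot E) (H3 : enum_axiom3 bot E) (nu tau : nat -> T) :
  effectively_optimal E nu -> E tau ->
  exists g, total_computable g /\ length_bounded g /\
    (forall x y, g x = g y -> x = y) /\ forall x, tau x = nu (g x).
Proof.
  intros [_ Hnu] Htau.
  set (f := fun d => if excluded_middle_informative (exists s, noncolliding d s = true)
                     then Some (slice_arg d) else None).
  assert (Hf : partial_computable f).
  { apply (partial_computable_search noncolliding slice_arg);
      [apply computable_noncolliding | apply computable_slice_arg, computable_id |].
    intros d y. unfold f. destruct excluded_middle_informative; split; intros H.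
    - injection H as <-. auto.
    - now destruct H as [-> _].
    - discriminate.
    - now destruct H. }
  specialize (H1 tau Htau f Hf).
  destruct (H3 _ H1 _ (enumerable_search _ computable_first_of_collision))
    as (rho & Erho & Hrho & Hbot).
  destruct (Hnu rho Erho) as (h & Ch & Bh & Eh).
  destruct (universal_complete h Ch) as [e He].
  assert (Hstep : forall k, exists s, forall i, i <= k ->
            universal e (slice e i) s = S (h (slice e i))).
  { intros k. destruct (universal_uniform e (fun x => h x) (S (slice e k)) He) as [s Hs].
    exists s. intros i Hi. apply Hs. pose proof (S_slice e i). pose proof (S_slice e k). nia. }
  assert (Hsound : forall i s, universal e (slice e i) s <> 0 ->
            universal e (slice e i) s = S (h (slice e i))).
  { intros i s Hs. apply universal_sound; auto. }
  assert (Hinj : forall x y, x < y -> h (slice e x) <> h (slice e y)).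
  { intros x' y Hxy' Heq'.
    (* Only the first argument that takes a repeated value passes [slice_fresh], so [x'] is replaced
       by the least argument sharing the value at [y]. *)
    set (x := least (fun i => h (slice e i) =? h (slice e y)) (S x')).
    destruct (least_prop (fun i => h (slice e i) =? h (slice e y)) (S x') x')
      as [Heq Hle]; [lia | now apply Nat.eqb_eq |]. fold x in Heq, Hle.
    apply Nat.eqb_eq in Heq. assert (Hxy : x < y) by lia.
    assert (Hfirst : forall i, i < x -> h (slice e i) <> h (slice e x)).
    { intros i Hi Hc. unfold x in Hi.
      destruct (least_prop (fun i => h (slice e i) =? h (slice e y)) (S x') i) as [_ ?];
        [lia | apply Nat.eqb_eq; congruence | lia]. }
    destruct (Hstep y) as [s Hs].
    (* The collision forces [rho] to agree at [slice e x] and [slice e y], since [rho] is [nu] after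
       [h]. At the former it avoids [bot]; at the latter it equals [bot], because [y] is not fresh
       and so neither search ever succeeds there. *)
    apply (Hbot (slice e x)).
    - exists (pairn y s). apply first_of_collision_slice. rewrite fstn_pairn, sndn_pairn.
      repeat split; [lia | | |].
      + intros i Hi. rewrite Hs by lia. discriminate.
      + intros i Hi. rewrite !Hs by lia. intros [=]. now apply (Hfirst i).
      + rewrite !Hs by lia. congruence.
    - rewrite Eh, Heq, <- Eh, Hrho.
      + unfold f. destruct excluded_middle_informative as [[t Ht]|]; auto. exfalso.
        apply noncolliding_slice in Ht. destruct Ht as [Hn Ht].
        apply (Ht x Hxy). rewrite !Hsound by (apply Hn; lia). congruence.
      + intros [w Hw]. apply first_of_collision_slice in Hw.
        destruct Hw as (Hyw & Hn & Ht & _). apply (Ht x Hxy).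
        rewrite !Hsound by (apply Hn; lia). congruence. }
  exists (fun x => h (slice e x)). repeat split.
  - auto with comp.
  - apply length_bounded_iff_linear in Bh. destruct Bh as [b Hb].
    (* From [S (slice e x) = 2 ^ e * (2 * x + 1) <= 2 ^ S e * S x]. *)
    apply length_bounded_iff_linear. exists (b * 2 ^ S e). intros x.
    specialize (Hb (slice e x)). rewrite S_slice in Hb. simpl Nat.pow. nia.
  - intros x y Hxy. destruct (lt_eq_lt_dec x y) as [[H|]|H]; auto.
    + now apply Hinj in H.
    + symmetry in Hxy. now apply Hinj in H.
  - intros x. rewrite <- Eh, Hrho.
    + unfold f. destruct excluded_middle_informative as [|Hn].
      * now rewrite slice_arg_slice.
      * exfalso. apply Hn. destruct (Hstep x) as [s Hs]. exists s.
        apply noncolliding_slice. split; intros i Hi; rewrite !Hs by lia; [discriminate|].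
        intros [=]. now apply (Hinj i x).
    + intros [w Hw]. apply first_of_collision_slice in Hw.
      destruct Hw as (Hxw & Hn & _ & Heq). rewrite !Hsound in Heq by (apply Hn; lia).
      injection Heq as Heq. symmetry in Heq. now apply Hinj in Heq.
Qed.

(** * The matching *)

Lemma count_mono P Q n : (forall i, i < n -> P i = true -> Q i = true) -> count P n <= count Q n.
Proof.
  induction n as [|n IH]; intros H; auto. rewrite !count_S.
  assert (count P n <= count Q n) by (apply IH; auto).
  specialize (H n (Nat.lt_succ_diag_r n)). destruct (P n); [rewrite H by auto|]; simpl; lia.
Qed.

Lemma count_mono_bound P m n : m <= n -> count P m <= count P n.
Proof. induction 1; auto. rewrite count_S. lia. Qed.

Lemma count_widen P m n : m <= n -> (forall i, P i = true -> i < m) -> count P n = count P m.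
Proof.
  intros Hmn HP. induction Hmn as [|n Hmn IH]; auto. rewrite count_S, IH.
  destruct (P n) eqn:E; auto. apply HP in E. lia.
Qed.

Lemma count_split P Q n :
  count P n = count (fun i => P i && Q i) n + count (fun i => P i && negb (Q i)) n.
Proof.
  induction n as [|n IH]; auto. rewrite !count_S, IH. destruct (P n), (Q n); simpl; lia.
Qed.

Lemma count_remove P j n : j < n -> P j = true ->
  count P n = S (count (fun i => P i && negb (i =? j)) n).
Proof.
  intros Hj HP. rewrite (count_split P (fun i => i =? j)). change (S ?x) with (1 + x). f_equal.
  induction Hj as [|n Hj IH]; rewrite count_S.
  - rewrite HP, Nat.eqb_refl. simpl. f_equal. apply count_zero. intros i Hi.
    apply andb_false_iff. right. apply Nat.eqb_neq. lia.
  - rewrite IH. assert (E : n =? j = false) by (apply Nat.eqb_neq; lia).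
    now rewrite E, andb_false_r.
Qed.

Lemma count_inj (f : nat -> nat) P Q n m :
  (forall i, i < n -> P i = true -> f i < m /\ Q (f i) = true) ->
  (forall i j, i < j -> j < n -> P i = true -> P j = true -> f i <> f j) ->
  count P n <= count Q m.
Proof.
  revert Q. induction n as [|n IH]; intros Q Hf Hinj; [apply Nat.le_0_l|].
  rewrite count_S. destruct (P n) eqn:E; simpl Nat.b2n.
  - destruct (Hf n) as [Hm HQ]; auto.
    rewrite (count_remove Q (f n) m Hm HQ). apply le_n_S. apply IH; [|auto].
    intros i Hi HP. destruct (Hf i) as [? ?]; auto. split; auto.
    apply andb_true_iff. split; auto. apply negb_true_iff, Nat.eqb_neq. auto.
  - apply IH; auto.
Qed.

(** Meant for [f] the labels at the previous level bound, whose fibres are the smaller blocks. *)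
Lemma count_eq_by_fibres P Q (f : nat -> nat) n m :
  (forall i, P i = true -> f i < m) -> (forall i, Q i = true -> f i < m) ->
  (forall a, a < m ->
    count (fun i => P i && (f i =? a)) n = count (fun i => Q i && (f i =? a)) n) ->
  count P n = count Q n.
Proof.
  intros HP HQ Ha.
  assert (H : forall k, k <= m ->
    count (fun i => P i && (f i <? k)) n = count (fun i => Q i && (f i <? k)) n).
  { induction k as [|k IH]; intros Hk.
    - apply count_ext. intros i _. now rewrite !andb_false_r.
    - rewrite (count_split (fun i => P i && _) (fun i => f i =? k)).
      rewrite (count_split (fun i => Q i && _) (fun i => f i =? k)).
      assert (Hs : forall i (b : bool), (b && (f i <? S k)) && (f i =? k) = b && (f i =? k) /\
                (b && (f i <? S k)) && negb (f i =? k) = b && (f i <? k)).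
      { intros i b. destruct b, (Nat.ltb_spec (f i) (S k)), (Nat.ltb_spec (f i) k),
          (Nat.eqb_spec (f i) k); simpl; auto; lia. }
      f_equal.
      + etransitivity; [|etransitivity; [apply (Ha k); lia|]];
          apply count_ext; intros i _; now rewrite (proj1 (Hs i _)).
      + etransitivity; [|etransitivity; [apply IH; lia|]];
          apply count_ext; intros i _; now rewrite (proj2 (Hs i _)). }
  etransitivity; [|etransitivity; [apply (H m (le_n m))|]]; apply count_ext; intros i _.
  - destruct (P i) eqn:E; auto. symmetry. now apply Nat.ltb_lt, HP.
  - destruct (Q i) eqn:E; auto. now apply Nat.ltb_lt, HQ.
Qed.

Lemma count_lt P u v : u < v -> P u = true -> count P u < count P v.
Proof.
  intros H HP. apply Nat.lt_le_trans with (count P (S u)).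
  - rewrite count_S, HP. simpl. lia.
  - now apply count_mono_bound.
Qed.

Lemma count_attained P r n : r < count P n -> exists u, u < n /\ P u = true /\ count P u = r.
Proof.
  induction n as [|n IH]; [intros H; simpl in H; inversion H|].
  rewrite count_S. intros H. destruct (Nat.lt_ge_cases r (count P n)) as [Hr|Hr].
  - destruct (IH Hr) as (u & Hu & H'). exists u. split; [lia|auto].
  - exists n. destruct (P n); simpl in H; [|lia]. repeat split; lia.
Qed.

(** * Walks along [s], their blocks and the resulting involution *)

Section Matching.

Variables (s lev bound : nat -> nat).
Hypothesis s_inj : forall u v, s u = s v -> u = v.
Hypothesis s_odd : forall v, Nat.odd (s v) = negb (Nat.odd v).
Hypothesis lev_s : forall v, lev (s v) <= S (lev v).
Hypothesis lev_bound : forall n v, lev v <= S n -> v < bound n.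
Hypothesis bound_mono : forall n, bound n <= bound (S n).

(** Exits become fixed points, so a walk that leaves and a walk on a cycle are both eventually
    periodic and can be treated alike. *)
Definition stop (n v : nat) : nat := if lev v <=? n then s v else v.
Definition orbit (n v k : nat) : nat := natrec v (fun _ r => stop n r) k.

Lemma orbit_S n v k : orbit n v (S k) = stop n (orbit n v k).
Proof. reflexivity. Qed.

Lemma orbit_stop n v k : orbit n (stop n v) k = orbit n v (S k).
Proof. induction k as [|k IH]; auto. rewrite orbit_S, IH. reflexivity. Qed.

Lemma lev_orbit n v k : lev v <= S n -> lev (orbit n v k) <= S n.
Proof.
  intros Hv. induction k as [|k IH]; auto. rewrite orbit_S. unfold stop.
  destruct (Nat.leb_spec (lev (orbit n v k)) n); auto.
  pose proof (lev_s (orbit n v k)). lia.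
Qed.

Lemma orbit_periodic n v : lev v <= S n -> exists d, 1 <= d <= bound n /\
  forall k, bound n <= k -> orbit n v (k + d) = orbit n v k.
Proof.
  intros Hv.
  (* Pigeonhole: the walk takes [bound n + 1] positions among the numbers below [bound n]. *)
  assert (H : exists i j, i < j /\ j <= bound n /\ orbit n v i = orbit n v j).
  { apply NNPP. intros H.
    assert (Hc : count (fun _ => true) (S (bound n)) <= count (fun _ => true) (bound n)).
    { apply count_inj with (f := orbit n v).
      - intros i _ _. split; auto. apply lev_bound, lev_orbit, Hv.
      - intros i j Hij Hj _ _ E. apply H. exists i, j. repeat split; auto; lia. }
    rewrite count_S in Hc. simpl in Hc. lia. }
  destruct H as (i & j & Hij & Hj & E). exists (j - i). split; [lia|].
  assert (Hk : forall k, orbit n v ((k + i) + (j - i)) = orbit n v (k + i)).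
  { induction k as [|k IH].
    - replace (0 + i + (j - i)) with j by lia. auto.
    - change (orbit n v (S (k + i + (j - i))) = orbit n v (S (k + i))).
      now rewrite !orbit_S, IH. }
  intros k Hkn. replace k with ((k - i) + i) by lia. apply Hk.
Qed.

(* The least recurrent point of the walk from [v] that stops on leaving levels [<= n]: the exit
   point if the walk leaves, and the least element of its cycle otherwise. *)
Definition label (n v : nat) : nat :=
  least (fun a => exists_below (fun i => orbit n v (bound n + i) =? a) (S (bound n))) (bound n).

Lemma label_orbit n v : lev v <= S n -> exists k, label n v = orbit n v k.
Proof.
  intros Hv. unfold label. set (P := fun a => exists_below _ _).
  destruct (least_prop P (bound n) (orbit n v (bound n + 0))) as [H _].
  - apply lev_bound, lev_orbit, Hv.
  - apply exists_below_true. exists 0. rewrite Nat.eqb_refl. split; [lia|reflexivity].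
  - apply exists_below_true in H. destruct H as (i & _ & H). apply Nat.eqb_eq in H. eauto.
Qed.

Lemma lev_label n v : lev v <= S n -> lev (label n v) <= S n.
Proof. intros Hv. destruct (label_orbit n v Hv) as [k ->]. now apply lev_orbit. Qed.

(** One step shifts the observed window of [bound n + 1] times by one; a period [d <= bound n] finds
    the position lost at either end again inside the other window. *)
Lemma label_stop n v : lev v <= S n -> label n (stop n v) = label n v.
Proof.
  intros Hv. destruct (orbit_periodic n v Hv) as (d & Hd & Hp).
  apply least_ext. intros a _. apply eq_true_iff_eq. rewrite !exists_below_true.
  setoid_rewrite Nat.eqb_eq. setoid_rewrite orbit_stop. split.
  - intros (i & Hi & E). destruct (Nat.eq_dec i (bound n)) as [->|].
    + exists (S (bound n) - d). split; [lia|]. rewrite <- Hp by lia. rewrite <- E. f_equal. lia.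
    + exists (S i). split; [lia|]. rewrite <- E. f_equal. lia.
  - intros (i & Hi & E). destruct i as [|i].
    + exists (d - 1). split; [lia|]. rewrite <- E, <- (Hp (bound n + 0)) by lia. f_equal. lia.
    + exists i. split; [lia|]. rewrite <- E. f_equal. lia.
Qed.

Lemma label_s n v : lev v <= n -> label n (s v) = label n v.
Proof.
  intros Hv. rewrite <- (label_stop n v) by lia. unfold stop.
  now apply Nat.leb_le in Hv as ->.
Qed.

Lemma label_top n v : lev v = S n -> label n v = v.
Proof.
  intros Hv. destruct (label_orbit n v) as [k ->]; [lia|].
  induction k as [|k IH]; auto. rewrite orbit_S, IH. unfold stop.
  destruct (Nat.leb_spec (lev v) n); auto; lia.
Qed.

(** Every step allowed at bound [n] is allowed at [S n] too, so blocks only merge when the bound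
    grows. *)
Lemma label_label n v : lev v <= S n -> label (S n) (label n v) = label (S n) v.
Proof.
  intros Hv. destruct (label_orbit n v Hv) as [k ->].
  induction k as [|k IH]; auto. rewrite orbit_S. rewrite <- IH. unfold stop.
  destruct (Nat.leb_spec (lev (orbit n v k)) n); auto. apply label_s. lia.
Qed.

Lemma label_invariant {T : Type} (c : nat -> T) n v :
  (forall u, c (s u) = c u) -> lev v <= S n -> c (label n v) = c v.
Proof.
  intros Hc Hv. destruct (label_orbit n v Hv) as [k ->].
  induction k as [|k IH]; auto. rewrite orbit_S. unfold stop.
  destruct (_ <=? _); now rewrite ?Hc.
Qed.

Definition in_block (n a u : nat) : bool := (lev u <=? n) && (label n u =? a).

(** A block with exit [w] is an alternating path whose last vertex lies opposite to [w]. Odd size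
    means one vertex too many on that opposite side, which [w] compensates. A vertex that is not
    entered from a lower level has an empty block and is not absorbed. *)
Definition absorbed (w : nat) : bool :=
  Nat.odd (count (in_block (pred (lev w)) w) (bound (pred (lev w)))).

(** The bound at which [v] gets matched: its own level, or one less if it completes the block that
    it is the exit of. *)
Definition stage (v : nat) : nat := lev v - Nat.b2n (absorbed v).

Lemma stage_le n u : stage u <= n <-> lev u <= n \/ lev u = S n /\ absorbed u = true.
Proof. unfold stage. destruct (absorbed u); simpl; intuition (try lia; try discriminate). Qed.

Lemma lev_le_stage n u : stage u <= n -> lev u <= S n.
Proof. rewrite stage_le. lia. Qed.

Definition side (p : bool) (u : nat) : bool := eqb (Nat.odd u) p.

(** [s] maps one side of the block injectively to the other and can leave only by hitting [a]. That
    cannot happen if [a] is no exit, or if [a] lies on the side from which [s] starts. *)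
Lemma block_side_le n a p : lev a <> S n \/ Nat.odd a = p ->
  count (fun u => in_block n a u && side p u) (bound n) <=
  count (fun u => in_block n a u && side (negb p) u) (bound n).
Proof.
  intros Ha. apply count_inj with (f := s).
  - intros u _ Hu. unfold in_block, side in *.
    apply andb_true_iff in Hu as [Hu Hp]. apply andb_true_iff in Hu as [Hl Hlab].
    apply Nat.leb_le in Hl. apply Nat.eqb_eq in Hlab. apply eqb_prop in Hp.
    pose proof (lev_s u). split; [apply lev_bound; lia|].
    rewrite s_odd, Hp, eqb_reflx, andb_true_r, label_s, Hlab, Nat.eqb_refl, andb_true_r by lia.
    apply Nat.leb_le, Nat.nlt_ge. intros Hc.
    assert (E : lev (s u) = S n) by lia.
    assert (Ea : s u = a) by (now rewrite <- Hlab, <- label_s, label_top).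
    rewrite <- Ea, s_odd, Hp in Ha. destruct Ha, p; auto; discriminate.
  - intros i j Hij _ _ _ E. apply s_inj in E. lia.
Qed.

(** From the side opposite to the exit, [s] may hit [a]; adding [a] to the target repairs the
    injection at the cost of one. *)
Lemma block_side_le_S n a : lev a = S n ->
  count (fun u => in_block n a u && side (negb (Nat.odd a)) u) (bound n) <=
  S (count (fun u => in_block n a u && side (Nat.odd a) u) (bound n)).
Proof.
  intros Ha.
  transitivity (count (fun u => (in_block n a u || (u =? a)) && side (Nat.odd a) u) (bound n)).
  - apply count_inj with (f := s).
    + intros u _ Hu. unfold in_block, side in *.
      apply andb_true_iff in Hu as [Hu Hp]. apply andb_true_iff in Hu as [Hl Hlab].
      apply Nat.leb_le in Hl. apply Nat.eqb_eq in Hlab. apply eqb_prop in Hp.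
      pose proof (lev_s u). split; [apply lev_bound; lia|].
      rewrite s_odd, Hp, negb_involutive, eqb_reflx, andb_true_r, label_s, Hlab, Nat.eqb_refl,
        andb_true_r by lia.
      apply orb_true_iff. rewrite Nat.leb_le, Nat.eqb_eq.
      destruct (Nat.le_gt_cases (lev (s u)) n); auto. right.
      rewrite <- Hlab, <- label_s, label_top; auto; lia.
    + intros i j Hij _ _ _ E. apply s_inj in E. lia.
  - rewrite (count_remove _ a).
    + apply le_n_S, count_mono. intros u _ Hu. unfold in_block in *.
      destruct (u =? a), (lev u <=? n), (label n u =? a), (side (Nat.odd a) u); auto.
    + apply lev_bound. lia.
    + unfold side. now rewrite Nat.eqb_refl, eqb_reflx, orb_true_r.
Qed.

(** The block of [a], completed by [a] itself when it is an absorbed exit. *)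
Definition settled (n a : nat) (u : nat) : bool := (stage u <=? n) && (label n u =? a).

Lemma settled_in_block n a u : lev a <> S n \/ absorbed a = false ->
  settled n a u = in_block n a u.
Proof.
  intros Ha. unfold settled, in_block.
  destruct (Nat.eqb_spec (label n u) a) as [E|]; [|now rewrite !andb_false_r].
  rewrite !andb_true_r. apply eq_true_iff_eq. rewrite !Nat.leb_le, stage_le.
  split; [|auto]. intros [|[Hl Hab]]; auto.
  rewrite label_top in E by assumption. subst a. destruct Ha; congruence.
Qed.

Lemma settled_absorbed n a u : lev a = S n -> absorbed a = true ->
  settled n a u = in_block n a u || (u =? a).
Proof.
  intros Ha Hab. unfold settled, in_block. apply eq_true_iff_eq.
  rewrite orb_true_iff, !andb_true_iff, !Nat.leb_le, !Nat.eqb_eq, stage_le. split.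
  - intros [[|[Hl _]] E]; auto. right. now rewrite label_top in E.
  - intros [[? ?]| ->]; auto. split; [auto | now apply label_top].
Qed.

(** For an exit [a] the two inequalities leave an excess of 0 or 1 on the side opposite to [a].
    Parity tells which: an even block is balanced already, an odd one becomes so by adding [a]. *)
Lemma settled_balanced n a :
  count (fun u => settled n a u && side true u) (bound n) =
  count (fun u => settled n a u && side false u) (bound n).
Proof.
  set (j p := count (fun u => in_block n a u && side p u) (bound n)).
  destruct (Nat.eq_dec (lev a) (S n)) as [Ha|Ha].
  2: { assert (E : forall p, count (fun u => settled n a u && side p u) (bound n) = j p).
       { intros p. apply count_ext. intros u _. now rewrite settled_in_block by auto. }
       rewrite !E. apply Nat.le_antisymm; apply block_side_le; auto. }
  assert (Hle : j (Nat.odd a) <= j (negb (Nat.odd a))) by (apply block_side_le; auto).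
  assert (HleS : j (negb (Nat.odd a)) <= S (j (Nat.odd a))) by now apply block_side_le_S.
  assert (Hab : absorbed a = Nat.odd (j true + j false)).
  { unfold absorbed. rewrite Ha. simpl pred. f_equal.
    rewrite (count_split _ (side true)). f_equal. apply count_ext. intros u _.
    unfold side. now destruct (Nat.odd u). }
  destruct (absorbed a) eqn:Eab.
  - assert (E : forall p, count (fun u => settled n a u && side p u) (bound n) =
              Nat.b2n (side p a) + j p).
    { intros p. destruct (side p a) eqn:Ep.
      - rewrite (count_remove _ a).
        + simpl. f_equal. apply count_ext. intros u _. rewrite settled_absorbed by auto.
          destruct (Nat.eqb_spec u a) as [->|];
            [|now rewrite orb_false_r, andb_true_r].
          unfold in_block. destruct (Nat.leb_spec (lev a) n); [lia|].
          now rewrite andb_false_r.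
        + apply lev_bound. lia.
        + now rewrite settled_absorbed, Nat.eqb_refl, orb_true_r.
      - apply count_ext. intros u _. rewrite settled_absorbed by auto.
        destruct (Nat.eqb_spec u a) as [->|]; [|now rewrite orb_false_r].
        now rewrite Ep, !andb_false_r. }
    rewrite !E. unfold side. symmetry in Hab. apply Nat.odd_spec in Hab.
    destruct Hab as [k Hk]. destruct (Nat.odd a); simpl in *; lia.
  - assert (E : forall p, count (fun u => settled n a u && side p u) (bound n) = j p).
    { intros p. apply count_ext. intros u _. now rewrite settled_in_block by auto. }
    rewrite !E. symmetry in Hab. rewrite <- Nat.negb_even in Hab.
    apply negb_false_iff, Nat.even_spec in Hab.
    destruct Hab as [k Hk]. destruct (Nat.odd a); simpl in *; lia.
Qed.

Definition in_class (n a u : nat) : bool := (stage u =? n) && (label n u =? a).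

(** By subtraction: the completed block at [S n] is balanced, and its part of stage at most [n] is a
    disjoint union of completed blocks at [n], balanced as well. *)
Lemma class_balanced n a :
  count (fun u => in_class n a u && side true u) (bound n) =
  count (fun u => in_class n a u && side false u) (bound n).
Proof.
  destruct n as [|n].
  { pose proof (settled_balanced 0 a) as H. unfold in_class, settled in *.
    etransitivity; [|etransitivity; [apply H|]]; apply count_ext; intros u _;
      now destruct (stage u). }
  assert (Hsplit : forall p,
    count (fun u => settled (S n) a u && side p u) (bound (S n)) =
    count (fun u => ((stage u <=? n) && (label (S n) u =? a)) && side p u) (bound (S n)) +
    count (fun u => in_class (S n) a u && side p u) (bound (S n))).
  { intros p. rewrite (count_split _ (fun u => stage u <=? n)).
    unfold settled, in_class. f_equal; apply count_ext; intros u _;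
      destruct (Nat.leb_spec (stage u) n), (Nat.leb_spec (stage u) (S n)),
        (Nat.eqb_spec (stage u) (S n)), (label (S n) u =? a), (side p u); auto; lia. }
  pose proof (settled_balanced (S n) a) as H. rewrite !Hsplit in H.
  enough (E :
    count (fun u => ((stage u <=? n) && (label (S n) u =? a)) && side true u) (bound (S n)) =
    count (fun u => ((stage u <=? n) && (label (S n) u =? a)) && side false u) (bound (S n)))
    by lia.
  clear H Hsplit. apply count_eq_by_fibres with (f := label n) (m := bound n).
  1,2: intros u Hu; apply lev_bound, lev_label, lev_le_stage;
    apply andb_true_iff in Hu as [Hu _]; apply andb_true_iff in Hu as [Hu _];
    now apply Nat.leb_le.
  intros a' _.
  assert (E : forall p, count (fun u => ((stage u <=? n) && (label (S n) u =? a)) && side p u &&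
                (label n u =? a')) (bound (S n)) =
              if label (S n) a' =? a
              then count (fun u => settled n a' u && side p u) (bound n) else 0).
  { intros p.
    assert (Hpt : forall u, ((stage u <=? n) && (label (S n) u =? a)) && side p u &&
                (label n u =? a') = settled n a' u && side p u && (label (S n) a' =? a)).
    { intros u. unfold settled. destruct (Nat.leb_spec (stage u) n) as [Hs|]; auto.
      destruct (Nat.eqb_spec (label n u) a') as [<-|]; [|now rewrite !andb_false_r].
      rewrite label_label by now apply lev_le_stage.
      destruct (label (S n) u =? a), (side p u); auto. }
    destruct (label (S n) a' =? a) eqn:Ea.
    - rewrite <- (count_widen _ (bound n) (bound (S n)) (bound_mono n)).
      + apply count_ext. intros u _. now rewrite Hpt, andb_true_r.
      + intros u Hu. apply andb_true_iff in Hu as [Hu _]. apply andb_true_iff in Hu as [Hu _].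
        now apply lev_bound, lev_le_stage, Nat.leb_le.
    - apply count_zero. intros u _. now rewrite Hpt, andb_false_r. }
  rewrite !E, settled_balanced. reflexivity.
Qed.

(** Classes are matched in increasing order on both sides; as the sides have equal size, every rank
    also occurs on the opposite one. *)
Definition rank (v : nat) : nat :=
  count (fun u => in_class (stage v) (label (stage v) v) u && side (Nat.odd v) u) v.

Definition matched (v u : nat) : bool :=
  in_class (stage v) (label (stage v) v) u && side (negb (Nat.odd v)) u && (rank u =? rank v).

Definition mate (v : nat) : nat := least (matched v) (bound (stage v)).

Lemma matched_iff v u : matched v u = true <->
  stage u = stage v /\ label (stage v) u = label (stage v) v /\
  Nat.odd u = negb (Nat.odd v) /\ rank u = rank v.
Proof.
  unfold matched, in_class, side.
  rewrite !andb_true_iff, !Nat.eqb_eq, eqb_true_iff. tauto.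
Qed.

Lemma matched_sym v u : matched v u = true -> matched u v = true.
Proof.
  rewrite !matched_iff. intros (Hs & Hl & Ho & Hr). rewrite Hs, Hl, Ho, negb_involutive. auto.
Qed.

Lemma matched_unique v u u' : matched v u = true -> matched v u' = true -> u = u'.
Proof.
  assert (H : forall u u', matched v u = true -> matched v u' = true -> ~ u < u').
  { clear u u'. intros u u' Hu Hu' Hlt.
    apply matched_iff in Hu as (Hs & Hl & Ho & Hr).
    apply matched_iff in Hu' as (Hs' & Hl' & Ho' & Hr').
    assert (E : rank u < rank u'); [|lia].
    unfold rank. rewrite Hs, Hs', Hl, Hl', Ho, Ho'. apply count_lt; [exact Hlt|].
    unfold in_class, side. now rewrite Hs, Hl, Ho, !Nat.eqb_refl, eqb_reflx. }
  intros Hu Hu'. pose proof (H _ _ Hu Hu'). pose proof (H _ _ Hu' Hu). lia.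
Qed.

Lemma matched_mate v : matched v (mate v) = true.
Proof.
  set (n := stage v). set (a := label n v).
  assert (Hv : in_class n a v && side (Nat.odd v) v = true).
  { unfold in_class, side. fold n a. now rewrite !Nat.eqb_refl, eqb_reflx. }
  assert (Hlt : v < bound n) by now apply lev_bound, lev_le_stage.
  assert (Hr : rank v < count (fun u => in_class n a u && side (negb (Nat.odd v)) u) (bound n)).
  { apply Nat.lt_le_trans with (count (fun u => in_class n a u && side (Nat.odd v) u) (bound n)).
    - unfold rank. fold n a.
      apply (count_lt (fun u => in_class n a u && side (Nat.odd v) u)); assumption.
    - pose proof (class_balanced n a). destruct (Nat.odd v); simpl; lia. }
  apply count_attained in Hr as (u & Hu & Hcls & Hr).
  apply (least_prop (matched v) (bound n) u Hu). apply matched_iff.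
  unfold in_class, side in Hcls. apply andb_true_iff in Hcls as [Hcls Ho].
  apply andb_true_iff in Hcls as [Hs Hl].
  apply Nat.eqb_eq in Hs, Hl. apply eqb_prop in Ho.
  repeat split; auto. rewrite <- Hr. unfold rank. now rewrite Hs, Hl, Ho.
Qed.

Lemma mate_involutive v : mate (mate v) = v.
Proof.
  apply (matched_unique (mate v)); [apply matched_mate | apply matched_sym, matched_mate].
Qed.

Lemma odd_mate v : Nat.odd (mate v) = negb (Nat.odd v).
Proof. now apply matched_iff, matched_mate. Qed.

(** Mates share their stage, a stage never exceeds the level, and a vertex of stage [n] has level at
    most [n + 1]. *)
Lemma lev_mate v : lev (mate v) <= S (lev v).
Proof.
  pose proof (matched_mate v) as H. apply matched_iff in H as [H _].
  assert (lev (mate v) <= S (stage v)) by (apply lev_le_stage; lia).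
  unfold stage in *. lia.
Qed.

(** Mates share their label, which both reach by iterating [s]. *)
Lemma mate_invariant {T : Type} (c : nat -> T) v :
  (forall u, c (s u) = c u) -> c (mate v) = c v.
Proof.
  intros Hc. pose proof (matched_mate v) as H. apply matched_iff in H as (Hs & Hl & _).
  rewrite <- (label_invariant c (stage v) v Hc) by now apply lev_le_stage.
  rewrite <- Hl. symmetry. apply label_invariant; auto. apply lev_le_stage. lia.
Qed.

(** * Computability of the matching *)

Hypothesis computable_s : total_computable s.
Hypothesis computable_lev : total_computable lev.
Hypothesis computable_bound : total_computable bound.

Lemma computable_orbit n v k :
  total_computable n -> total_computable v -> total_computable k ->
  total_computable (fun z => orbit (n z) (v z) (k z)).
Proof.
  intros. apply (computable_natrec _ (fun i r z => stop (n z) r)); auto.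
  unfold stop. auto 10 with comp.
Qed.
Hint Resolve computable_orbit : comp.

Lemma computable_label n v : total_computable n -> total_computable v ->
  total_computable (fun z => label (n z) (v z)).
Proof.
  intros. unfold label. apply (computable_least (fun a z => exists_below
    (fun i => orbit (n z) (v z) (bound (n z) + i) =? a) (S (bound (n z))))); auto with comp.
  apply (computable_exists_below (fun i w => orbit (n (sndn w)) (v (sndn w))
    (bound (n (sndn w)) + i) =? fstn w) (fun w => S (bound (n (sndn w))))); auto 20 with comp.
Qed.
Hint Resolve computable_label : comp.

Lemma computable_absorbed v : total_computable v -> computable_test (fun z => absorbed (v z)).
Proof.
  intros. unfold absorbed, in_block. apply computable_test_odd.
  apply (computable_count (fun u z => (lev u <=? pred (lev (v z))) &&
    (label (pred (lev (v z))) u =? v z))); auto 20 with comp.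
Qed.
Hint Resolve computable_absorbed : comp.

Lemma computable_stage v : total_computable v -> total_computable (fun z => stage (v z)).
Proof. intros. unfold stage. auto 10 with comp. Qed.
Hint Resolve computable_stage : comp.

Lemma computable_rank v : total_computable v -> total_computable (fun z => rank (v z)).
Proof.
  intros. unfold rank, in_class, side.
  apply (computable_count (fun u z => (stage u =? stage (v z)) &&
    (label (stage (v z)) u =? label (stage (v z)) (v z)) &&
    eqb (Nat.odd u) (Nat.odd (v z)))); auto 20 with comp.
Qed.
Hint Resolve computable_rank : comp.

Lemma computable_mate v : total_computable v -> total_computable (fun z => mate (v z)).
Proof.
  intros. unfold mate, matched, in_class, side.
  apply (computable_least (fun u z => (stage u =? stage (v z)) &&
    (label (stage (v z)) u =? label (stage (v z)) (v z)) &&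
    eqb (Nat.odd u) (negb (Nat.odd (v z))) && (rank u =? rank (v z)))); auto 20 with comp.
Qed.

End Matching.

(** * The isomorphism *)

(** Integer division by 2, written as a bounded search to make its computability immediate. *)
Definition half (v : nat) : nat := least (fun i => v <=? S (2 * i)) (S v).

Lemma half_spec v : v = 2 * half v + Nat.b2n (Nat.odd v).
Proof.
  assert (H : forall x d, d <= 1 -> half (2 * x + d) = x).
  { intros x d Hd. unfold half.
    destruct (least_prop (fun i => 2 * x + d <=? S (2 * i)) (S (2 * x + d)) x) as [H1 H2];
      [lia | apply Nat.leb_le; lia |].
    apply Nat.leb_le in H1. lia. }
  rewrite (Nat.div2_odd v) at 1 2. rewrite H by (destruct (Nat.odd v); simpl; lia). lia.
Qed.

Lemma odd_double x : Nat.odd (2 * x) = false.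
Proof. rewrite Nat.odd_mul. reflexivity. Qed.

Lemma odd_S_double x : Nat.odd (S (2 * x)) = true.
Proof. now rewrite Nat.odd_succ, <- Nat.negb_odd, odd_double. Qed.

Lemma half_double x : half (2 * x) = x.
Proof. pose proof (half_spec (2 * x)) as H. rewrite odd_double in H. simpl Nat.b2n in H. lia. Qed.

Lemma half_S_double x : half (S (2 * x)) = x.
Proof.
  pose proof (half_spec (S (2 * x))) as H. rewrite odd_S_double in H. simpl Nat.b2n in H. lia.
Qed.

Lemma computable_half v : total_computable v -> total_computable (fun z => half (v z)).
Proof.
  intros. unfold half.
  apply (computable_least (fun i z => v z <=? S (2 * i))); auto 10 with comp.
Qed.
Hint Resolve computable_half : comp.

(** The number of digits of [S v] in base [b]: multiplying [S v] by at most [b] raises it by at most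
    one. The search range suffices for [1 < b], as then [S v < b ^ S v]. *)
Definition log_level (b v : nat) : nat := least (fun k => S v <? b ^ k) (S (S v)).

Lemma log_level_lt b v : 1 < b -> S v < b ^ log_level b v.
Proof.
  intros Hb. apply Nat.ltb_lt.
  apply (least_prop (fun k => S v <? b ^ k) (S (S v)) (S v)); [lia|].
  now apply Nat.ltb_lt, Nat.pow_gt_lin_r.
Qed.

Lemma log_level_le b v k : S v < b ^ k -> log_level b v <= k.
Proof.
  intros Hk. destruct (Nat.lt_ge_cases k (S (S v))) as [H|H].
  - apply (least_prop (fun k => S v <? b ^ k) (S (S v)) k); [exact H | now apply Nat.ltb_lt].
  - apply Nat.le_trans with (S (S v)); [apply count_le | exact H].
Qed.

Lemma le_log_level b v k : 1 < b -> k < log_level b v -> b ^ k <= S v.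
Proof.
  intros Hb Hk. apply Nat.nlt_ge. intros H. apply log_level_le in H. lia.
Qed.

Theorem theorem7p3 (T : Type) (bot : T) (E : (nat -> T) -> Prop)
  (H1 : enum_axiom1 bot E) (H2 : enum_axiom2 E) (H3 : enum_axiom3 bot E)
  (nu nu' : nat -> T)
  (Hnu : effectively_optimal E nu) (Hnu' : effectively_optimal E nu') :
  exists h hinv : nat -> nat,
    total_computable h /\
    (forall x, hinv (h x) = x) /\ (forall y, h (hinv y) = y) /\
    length_bounded h /\ length_bounded hinv /\
    (forall x, nu' x = nu (h x)).
Proof.
  destruct (injective_translation bot E H1 H3 nu nu' Hnu (proj1 Hnu'))
    as (g & Cg & Bg & Ig & Eg).
  destruct (injective_translation bot E H1 H3 nu' nu Hnu' (proj1 Hnu))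
    as (g' & Cg' & Bg' & Ig' & Eg').
  apply length_bounded_iff_linear in Bg as [b Hb].
  apply length_bounded_iff_linear in Bg' as [b' Hb'].
  (* Doubling a code to make it a vertex costs a factor 2, so [S (s v) <= B * S v] on both sides;
     the summand 2 ensures [1 < B]. *)
  set (B := 2 * (b + b') + 2).
  (* Codes of [nu'] are the even vertices, codes of [nu] the odd ones. *)
  set (s := fun v => if Nat.odd v then 2 * g' (half v) else S (2 * g (half v))).
  (* The object named by a vertex. It is constant along [s], hence preserved by mates, and this
     yields the final equation. *)
  set (c := fun v => if Nat.odd v then nu (half v) else nu' (half v)).
  set (lev := log_level B).
  set (bound := fun n => B ^ S n).
  assert (HB : 1 < B) by (unfold B; lia).
  assert (s_odd : forall v, Nat.odd (s v) = negb (Nat.odd v)).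
  { intros v. unfold s. destruct (Nat.odd v); [apply odd_double | apply odd_S_double]. }
  assert (s_inj : forall u v, s u = s v -> u = v).
  { intros u v Huv. assert (Ho : Nat.odd u = Nat.odd v).
    { apply (f_equal Nat.odd) in Huv. rewrite !s_odd in Huv.
      now destruct (Nat.odd u), (Nat.odd v). }
    rewrite (half_spec u), (half_spec v), Ho. do 2 f_equal.
    unfold s in Huv. rewrite Ho in Huv. destruct (Nat.odd v); [apply Ig' | apply Ig]; lia. }
  assert (s_c : forall v, c (s v) = c v).
  { intros v. unfold c. rewrite s_odd. unfold s.
    destruct (Nat.odd v); simpl negb; cbv iota; now rewrite ?half_double, ?half_S_double. }
  assert (lev_s : forall v, lev (s v) <= S (lev v)).
  { intros v. apply log_level_le. pose proof (log_level_lt B v HB) as Hv. fold lev in Hv.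
    assert (S (s v) <= B * S v); [|simpl Nat.pow; nia].
    pose proof (half_spec v). unfold s, B.
    pose proof (Hb (half v)). pose proof (Hb' (half v)).
    destruct (Nat.odd v); simpl Nat.b2n in *; nia. }
  assert (lev_bound : forall n v, lev v <= S n -> v < bound n).
  { intros n v Hv. pose proof (log_level_lt B v HB).
    assert (B ^ lev v <= B ^ S n) by (apply Nat.pow_le_mono_r; lia). unfold bound, lev in *. lia. }
  assert (bound_mono : forall n, bound n <= bound (S n)).
  { intros n. apply Nat.pow_le_mono_r; lia. }
  set (m := mate s lev bound).
  assert (m_odd : forall v, Nat.odd (m v) = negb (Nat.odd v)) by now apply odd_mate.
  assert (m_inv : forall v, m (m v) = v) by now apply mate_involutive.
  assert (m_c : forall v, c (m v) = c v) by (intros v; now apply mate_invariant).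
  (* One factor [B] is the rounding of [S v] to a power of [B], the other the level gained by the
     mate. *)
  assert (m_linear : forall v, S (m v) <= B * B * S v).
  { intros v. pose proof (log_level_lt B (m v) HB) as Hm.
    assert (Hl : lev (m v) <= S (lev v)) by now apply lev_mate.
    assert (Hp : B ^ lev (m v) <= B ^ S (lev v)) by (apply Nat.pow_le_mono_r; lia).
    fold (lev (m v)) in Hm. destruct (lev v) as [|k] eqn:Ek.
    - simpl Nat.pow in Hp. nia.
    - assert (B ^ k <= S v) by (apply le_log_level; [exact HB | fold (lev v); lia]).
      simpl Nat.pow in Hp. nia. }
  assert (C_m : forall v, total_computable v -> total_computable (fun z => m (v z))).
  { apply computable_mate.
    - unfold s. auto 20 with comp.
    - unfold lev, log_level.
      apply (computable_least (fun k v => S v <? B ^ k)); auto 20 with comp.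
    - unfold bound. auto with comp. }
  assert (even_half : forall v, Nat.odd v = false -> 2 * half v = v).
  { intros v Hv. pose proof (half_spec v) as H. rewrite Hv in H. simpl Nat.b2n in H. lia. }
  assert (odd_half : forall v, Nat.odd v = true -> S (2 * half v) = v).
  { intros v Hv. pose proof (half_spec v) as H. rewrite Hv in H. simpl Nat.b2n in H. lia. }
  exists (fun x => half (m (2 * x))), (fun y => half (m (S (2 * y)))).
  split; [|split; [|split; [|split; [|split]]]].
  - auto 10 with comp.
  - intros x. rewrite odd_half by (now rewrite m_odd, odd_double).
    now rewrite m_inv, half_double.
  - intros y. rewrite even_half by (now rewrite m_odd, odd_S_double).
    now rewrite m_inv, half_S_double.
  - apply length_bounded_iff_linear. exists (2 * (B * B)). intros x.
    pose proof (m_linear (2 * x)). pose proof (half_spec (m (2 * x))). nia.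
  - apply length_bounded_iff_linear. exists (2 * (B * B)). intros y.
    pose proof (m_linear (S (2 * y))). pose proof (half_spec (m (S (2 * y)))). nia.
  - intros x. pose proof (m_c (2 * x)) as Hc. unfold c in Hc.
    rewrite m_odd, odd_double, half_double in Hc. now symmetry.
Qed.
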